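(* Let $\mathbb G$ be an ideal Carnot group with CC distance $d$ and $d_0=d(\cdot,0)$. Then $d_0^2$ is h-semiconcave in $\mathbb G$.
   Context: A Carnot group is ideal if (equivalently) it is fat: it has step 2 (see below) and for every $X\in\mathfrak g_1\setminus\{0\}$, $\mathfrak g_1+[\mathfrak g_1,X]=\mathfrak g$; equivalently, its canonical sub-Riemannian structure is complete and admits no non-constant abnormal length-minimizing geodesics. A step 2 Carnot group $\mathbb G$ is a connected, simply connected Lie group whose Lie algebra splits as $\mathfrak g=\mathfrak g_1\oplus\mathfrak g_2$ with $[\mathfrak g_1,\mathfrak g_1]=\mathfrak g_2\neq\{0\}$, $[\mathfrak g_1,\mathfrak g_2]=\{0\}$; it is identified with $\mathbb R^n=\mathbb R^m\times\mathbb R^{n_2}$, $p=(p^{(1)},p^{(2)})$, with law $p\cdot q=(p^{(1)}+q^{(1)},p^{(2)}+q^{(2)}+\mathcal B(p^{(1)},q^{(1)}))$, $\mathcal B$ skew-symmetric bilinear; identity $0$, $p^{-1}=-p$. $X_1,\dots,X_m$ are the left-invariant vector fields equal to $\partial/\partial p_i$ at $0$. The CC distance $d(p,q)$ is the infimum of $\int_0^1|u|$ over absolutely continuous $\gamma:[0,1]\to\mathbb G$ from $p$ to $q$ with $\dot\gamma=\sum u_iX_i(\gamma)$ a.e. $\mathcal H_0=\mathbb R^m\times\{0\}$; $|\cdot|$ is the Euclidean norm. A lower semicontinuous $u$ on open $\Omega$ is h-semiconcave if there is $C\ge0$ with $u(p\cdot h)+u(p\cdot h^{-1})-2u(p)\le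 C|h|^2$ for all $p\in\Omega$, $h\in\mathcal H_0$ with $\{p\cdot\tau h:\tau\in[-1,1]\}\subset\Omega$. *)

(* Defs.v *)
From HB Require Import structures.
From mathcomp Require Import all_boot all_order all_algebra.
From mathcomp Require Import all_classical all_reals all_analysis.
Set Implicit Arguments. Unset Strict Implicit. Unset Printing Implicit Defensive.
Import Order.TTheory GRing.Theory Num.Theory.
Import numFieldNormedType.Exports.
Local Open Scope classical_set_scope.
Local Open Scope ring_scope.

Section CarnotDefs.
Variables (R : realType) (m n2 : nat).

Definition carnot_pt := ('rV[R]_m * 'rV[R]_n2)%type.

Definition enorm k (x : 'rV[R]_k) : R := Num.sqrt (\sum_(i < k) x 0 i ^+ 2).
Definition pnorm (p : carnot_pt) : R :=
  Num.sqrt (\sum_(i < m) p.1 0 i ^+ 2 + \sum_(i < n2) p.2 0 i ^+ 2).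
Definition pdist (p q : carnot_pt) : R := pnorm (p.1 - q.1, p.2 - q.2).

Variable B : 'rV[R]_m -> 'rV[R]_m -> 'rV[R]_n2.

Definition skew_bilinear : Prop :=
  (forall (a : R) x x' y, B (a *: x + x') y = a *: B x y + B x' y) /\
  (forall x y, B x y = - B y x).

Definition gmul (p q : carnot_pt) : carnot_pt := (p.1 + q.1, p.2 + q.2 + B p.1 q.1).

(* Lie algebra g = g1 (+) g2 identified with R^m x R^{n2}; the bracket of the
   left-invariant vector fields equal at 0 to V and W (computed from the
   group law) is [V, W] = (0, 2 B(V1, W1)). *)
Definition lie_bracket (V W : carnot_pt) : carnot_pt := (0, 2%:R *: B V.1 W.1).
Definition in_g1 (V : carnot_pt) : Prop := V.2 = 0.
Definition in_g2 (V : carnot_pt) : Prop := V.1 = 0.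

(* step 2: [g1, g1] = g2 <> {0}  ([g1,g2] = 0 is automatic for this bracket) *)
Definition step2 : Prop :=
  (0 < n2)%N /\
  forall Z : carnot_pt, in_g2 Z ->
    exists (k : nat) (Y W : 'I_k -> carnot_pt),
      (forall i, in_g1 (Y i)) /\ (forall i, in_g1 (W i)) /\
      Z = \sum_(i < k) lie_bracket (Y i) (W i).

Definition fat : Prop :=
  forall X : carnot_pt, in_g1 X -> X <> 0 ->
    forall Z : carnot_pt, exists Y1 Y2 : carnot_pt,
      in_g1 Y1 /\ in_g1 Y2 /\ Z = Y1 + lie_bracket Y2 X.

Definition ideal_carnot : Prop := skew_bilinear /\ step2 /\ fat.

Definition abs_cont01 (V : normedModType R) (f : R -> V) : Prop :=
  forall eps : R, 0 < eps -> exists2 delta : R, 0 < delta &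
    forall (k : nat) (a b : 'I_k -> R),
      (forall i, 0 <= a i /\ a i <= b i /\ b i <= 1) ->
      (forall i j, i != j -> b i <= a j \/ b j <= a i) ->
      \sum_(i < k) (b i - a i) < delta ->
      \sum_(i < k) `|f (b i) - f (a i)| < eps.

(* gamma = (g1, g2) satisfies gamma' = sum_i u_i X_i(gamma) a.e. on [0,1];
   X_i(p) = (e_i, B(p1, e_i)) *)
Definition horizontal (g1 : R -> 'rV[R]_m) (g2 : R -> 'rV[R]_n2)
    (u : R -> 'rV[R]_m) : Prop :=
  {ae (@lebesgue_measure R), forall t : R, t \in `[0, 1] ->
     [/\ derivable g1 t 1, derivable g2 t 1,
         derive1 g1 t = u t & derive1 g2 t = B (g1 t) (u t)]}.

Definition cc_lengths (p q : carnot_pt) : set (\bar R) :=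
  [set l | exists (g1 : R -> 'rV[R]_m) (g2 : R -> 'rV[R]_n2) (u : R -> 'rV[R]_m),
     [/\ abs_cont01 g1 /\ abs_cont01 g2,
         (forall i : 'I_m, measurable_fun `[(0:R)%R, (1:R)%R] (fun t => u t 0 i)),
         horizontal g1 g2 u,
         (g1 0, g2 0) = p /\ (g1 1, g2 1) = q &
         l = (\int[@lebesgue_measure R]_(t in `[(0:R)%R, (1:R)%R]) (enorm (u t))%:E)%E]].

(* Carnot-Caratheodory distance (extended-real valued, +oo if no curve) *)
Definition cc_dist (p q : carnot_pt) : \bar R := ereal_inf (cc_lengths p q).

Definition eopen (O : set carnot_pt) : Prop :=
  forall p, O p -> exists2 r : R, 0 < r & forall q, pdist q p < r -> O q.

Definition lsc_on (O : set carnot_pt) (f : carnot_pt -> R) : Prop :=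
  forall p, O p -> forall eps : R, 0 < eps -> exists2 delta : R, 0 < delta &
    forall q, O q -> pdist q p < delta -> f p - eps < f q.

(* h in H_0 is (h1, 0); its inverse is (-h1, 0); tau h = (tau h1, 0) *)
Definition h_semiconcave (O : set carnot_pt) (f : carnot_pt -> R) : Prop :=
  eopen O /\ lsc_on O f /\
  exists2 C : R, 0 <= C &
    forall p (h1 : 'rV[R]_m), O p ->
      (forall tau : R, -1 <= tau <= 1 -> O (gmul p (tau *: h1, 0))) ->
      f (gmul p (h1, 0)) + f (gmul p (- h1, 0)) - 2%:R * f p
        <= C * enorm h1 ^+ 2.

End CarnotDefs.

(* Main.v *)
Require Import Defs.
From HB Require Import structures.
From mathcomp Require Import all_boot all_order all_algebra.
From mathcomp Require Import all_classical all_reals all_analysis.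
From mathcomp Require Import measurable_realfun ring lra.
Import Order.TTheory GRing.Theory Num.Theory.
Import numFieldNormedType.Exports.
Local Open Scope classical_set_scope.
Local Open Scope ring_scope.
Set Implicit Arguments. Unset Strict Implicit. Unset Printing Implicit Defensive.

(** All curves run from a point [p] to the identity.  Let [u] be the control of
    such a curve, of length [l] at most twice the distance.  By the ball-box
    upper bound the projection of the curve to [R^m] must leave a ball of radius
    comparable to [l].  Perturb [u] into [u - |u| om]: the weight [|u|] plays the
    role of arc length, so that no reparametrization of the curve is needed, and
    [|u - |u| om| <= |u| - u.om + |u| |om|^2 / 2].  Taking
    [om = h / l + th a], where [th] is one centred coordinate of the projected
    curve, the starting point moves exactly by [h] horizontally and by an affine
    function of [a] vertically, with linear part [B (2 M - kap h)]; the vector [M]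
    is bounded below by the variance of that coordinate.  Fatness therefore
    allows to solve for [a] any vertical displacement, with uniform bounds, so
    the points [p h] and [p h^-1] are both reached, with first-order variations
    of the length that cancel up to [O(|h|^2 / l)].  When [|h|] is not small with
    respect to the distance, the ball-box bound suffices.  No minimizer is ever
    needed. *)

(** * Monotonicity of absolutely continuous functions from the sign of the derivative almost
    everywhere *)

Section AbsolutelyContinuous.
Variable R : realType.
Notation mu := (@lebesgue_measure R).
Implicit Types f g F : R -> R.

(** Ordered lists are what the sweep from left to right in [abs_cont01_le] produces; [pairwise]
    supplies the disjointness asked for by [abs_cont01]. *)
Lemma abs_cont01_seq (V : normedModType R) (f : R -> V) (eps : R) :
  abs_cont01 f -> 0 < eps -> exists2 delta : R, 0 < delta &
    forall s : seq (R * R),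
      (forall p, p \in s -> 0 <= p.1 /\ p.1 <= p.2 /\ p.2 <= 1) ->
      pairwise (fun p q => p.2 <= q.1) s ->
      \sum_(p <- s) (p.2 - p.1) < delta ->
      \sum_(p <- s) `|f p.2 - f p.1| < eps.
Proof.
move=> acf /acf[d d0 H]; exists d => // s sE sP sd.
have /= := H (size s) (fun i => (nth 0 s i).1) (fun i => (nth 0 s i).2).
rewrite -(big_mkord xpredT (fun i => `|f (nth 0 s i).2 - f (nth 0 s i).1|)).
rewrite -(big_mkord xpredT (fun i => (nth 0 s i).2 - (nth 0 s i).1)).
rewrite -(big_nth 0 xpredT (fun p : R * R => `|f p.2 - f p.1|)).
rewrite -(big_nth 0 xpredT (fun p : R * R => p.2 - p.1)).
apply => //.
  by move=> i; apply: sE; rewrite mem_nth.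
move=> i j ij; have /(pairwiseP 0) sP' := sP.
have [ltij|] := ltnP i j; first by left; apply: sP' => //; rewrite inE ltn_ord.
rewrite leq_eqVlt => /orP[/eqP ji|ltji].
  by move: ij; rewrite -val_eqE /= ji eqxx.
by right; apply: sP' => //; rewrite inE ltn_ord.
Qed.

(** Continuous induction. The supremum of the points satisfying [Q] is itself reached from a nearby
    point on its left, and if it were below [b] the same step would carry [Q] beyond it. *)
Lemma real_ind (a b : R) (Q : R -> Prop) : a <= b -> Q a ->
  (forall x, a <= x <= b -> exists2 d, 0 < d &
    forall y z, a <= y -> y <= x -> x <= z -> z <= b -> x - d < y -> z < x + d ->
      Q y -> Q z) -> Q b.
Proof.
move=> ab Qa step.
pose S := [set t | a <= t <= b /\ Q t].
have Sa : S a by split=> //; rewrite lexx.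
have Sub : ubound S b by move=> t [/andP[]].
have hS : has_sup S by split; [exists a|exists b].
have ac : a <= sup S by apply: ub_le_sup => //; exists b.
have cb : sup S <= b by apply: ge_sup => //; exists a.
have [|d d0 H] := step (sup S); first by rewrite ac.
have [y [/andP[ay yb] Qy] ySd] := sup_adherent d0 hS.
have yc : y <= sup S by apply: ub_le_sup; [exists b|split=> //; rewrite ay].
have Hz z : sup S <= z -> z <= b -> z < sup S + d -> Q z.
  by move=> cz zb zd; apply: (H y z).
have [bd|db] := ltP b (sup S + d); first exact: Hz.
have : sup S + d / 2 <= sup S.
  apply: ub_le_sup; first by exists b.
  split; last by apply: Hz; lra.
  by apply/andP; split; lra.
lra.
Qed.

(* Cousin-type argument: away from a null set [F] is infinitesimally almost
   nondecreasing, and the null set is covered by an open set so small that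
   absolute continuity controls the variation of [F] there. *)
Lemma abs_cont01_le F (a b : R) : abs_cont01 F ->
  {ae mu, forall t : R, t \in `[0, 1] -> exists2 l : R, 0 <= l & is_derive t 1 F l} ->
  0 <= a -> a <= b -> b <= 1 -> F a <= F b.
Proof.
move=> acF aeF a0 ab b1; apply/ler_addgt0Pr => e' e'0.
have [e e0 ->] : exists2 e, 0 < e & e' = 2 * e by exists (e' / 2); lra.
have [d d0 Hd] := abs_cont01_seq acF e0.
case: aeF => N [mN N0 sN].
have [ O [oO NO Od]] : exists U : set R, [/\ open U, N `<=` U & (mu (U `\` N) < d%:E)%E].
  by apply: lebesgue_regularity_outer => //; rewrite [X in (X < _)%E]N0.
have Od1 : (mu O < d%:E)%E.
  have mO : measurable O by apply: open_measurable.
  have -> : O = (O `\` N) `|` N by rewrite setDE setUIl setUCl setIT setUidl.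
  rewrite (le_lt_trans (measureU2 _ _ _))//.
  - exact: measurableD.
  - by rewrite [X in (_ + X)%E]N0 adde0.
(* The list [s] records intervals inside [O], where the derivative gives no information. Their total
   length is charged to the measure of [O], hence stays below [d]; elsewhere [F] loses at most [e]
   per unit of length. *)
pose Q t := exists s : seq (R * R),
  [/\ (forall p, p \in s -> a <= p.1 /\ p.1 <= p.2 /\ p.2 <= t),
     pairwise (fun p q => p.2 <= q.1) s,
     ((\sum_(p <- s) (p.2 - p.1))%:E <= mu (O `&` `[a, t]))%E &
     - e * (t - a) - \sum_(p <- s) `|F p.2 - F p.1| <= F t - F a].
suff [s [sE sP sO sF]] : Q b.
  have : \sum_(p <- s) `|F p.2 - F p.1| < e.
    apply: Hd => //.
      by move=> p /sE[? [? ?]]; split; [lra|split=> //; lra].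
    rewrite -lte_fin; apply: le_lt_trans Od1; apply: le_trans sO _.
    apply: le_measure; rewrite ?inE//.
    - by apply: measurableI => //; exact: open_measurable.
    - exact: open_measurable.
  by move: sF; nra.
apply: (@real_ind a b Q ab).
  exists [::]; split=> //.
    by rewrite big_nil measure_ge0.
  by rewrite big_nil; lra.
move=> x /andP[ax xb].
(* It remains to prove a local alternative at each [x]: short intervals around [x] either have slope
   at least [- e], and [s] is kept, or lie in [O], and are appended to [s]. *)
suff [r r0 Hr] : exists2 r, 0 < r & forall y z, a <= y -> y <= x -> x <= z -> z <= b ->
    x - r < y -> z < x + r -> - e * (z - y) <= F z - F y \/ `[y, z] `<=` O.
  exists r => // y z ay yx xz zb ry zr [s [sE sP sO sF]].
  have yz := le_trans yx xz.
  have [Fyz|yzO] := Hr _ _ ay yx xz zb ry zr.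
    exists s; split=> //.
    - by move=> p /sE[? [? py]]; split=> //; split=> //; exact: le_trans py yz.
    - apply: le_trans sO _; apply: le_measure; rewrite ?inE//.
      + by apply: measurableI => //; exact: open_measurable.
      + by apply: measurableI => //; exact: open_measurable.
      + by apply: setIS; apply: subset_itvl; rewrite bnd_simp.
    - by clear - sF Fyz; lra.
  exists (rcons s (y, z)); split.
  - move=> p; rewrite mem_rcons inE => /predU1P[->//|/sE[? [? py]]].
    by split=> //; split=> //; exact: le_trans py yz.
  - rewrite pairwise_rcons sP andbT; by apply/allP => p /sE[_ []].
  - rewrite big_rcons/= EFinD.
    (* The half-open interval is disjoint from [[a, y]], so that the measures add up. *)
    have -> : (z - y)%:E = mu (`]y, z]).
      rewrite [RHS]lebesgue_measure_itv/= lte_fin; case: ltP => [//|zy].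
      by have -> : z - y = 0 by clear - zy yz; lra.
    apply: (@le_trans _ _ (mu (O `&` `[a, y]) + mu (`]y, z]))%E).
      exact: leeD.
    rewrite -measureU//.
    + apply: le_measure; rewrite ?inE//.
      * apply: measurableU => //; apply: measurableI => //.
        exact: open_measurable.
      * by apply: measurableI => //; exact: open_measurable.
      * move=> t [[Ot]|] /=; rewrite !in_itv/= => /andP[t1 t2].
          by split=> //; rewrite t1 (le_trans t2 yz).
        split; first by apply: yzO; rewrite /= in_itv/= (ltW t1) t2.
        by rewrite (le_trans ay (ltW t1)) t2.
    + by apply: measurableI => //; exact: open_measurable.
    + rewrite -subset0 => t [[_]] /=; rewrite !in_itv/=.
      by move=> /andP[_ ty] /andP[]; rewrite ltNge ty.
  - rewrite big_rcons/=.
    have : - `|F z - F y| <= F z - F y by rewrite lerNl ler_normr lexx orbT.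
    have : 0 <= e * (z - y) by rewrite mulr_ge0 ?(ltW e0)// subr_ge0.
    by clear - sF; lra.
have [xN|xN] := pselect (N x).
  have /nbhs_ballP[r /= r0 rO] : nbhs x O by apply: open_nbhs_nbhs; split=> //; exact: NO.
  exists r => // y z ay yx xz zb ry zr; right => t /=; rewrite in_itv/= => /andP[yt tz].
  by apply: rO; rewrite /ball/= ltr_distlC; clear - ay yx xz zb ry zr yt tz;
    apply/andP; split; lra.
have : exists2 l : R, 0 <= l & is_derive x 1 F l.
  apply: contrapT => nH; apply: xN; apply: sN => /= H; apply: nH.
  by apply: H; rewrite in_itv/=; apply/andP; split; lra.
move=> [l l0 dF].
have dFl : h^-1 *: (F (h *: 1 + x) - F x) @[h --> 0^'] --> l.
  have <- : 'D_1 F x = l by rewrite derive_val.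
  by have := @ex_derive _ _ _ _ _ _ _ dF; rewrite /derivable.
have /cvgrPdist_lt/(_ _ e0) := dFl.
move=> [r /= r0 Hr]; exists r => // y z ay yx xz zb ry zr; left.
(* The increment over [[y, z]] is split at [x], so that only difference quotients based at [x]
   occur. *)
have Hx t : `|t - x| < r -> t != x -> - e <= (F t - F x) / (t - x).
  move=> tr tx; have := Hr (t - x); rewrite /= /ball_/= sub0r normrN => /(_ tr).
  rewrite subr_eq0 => /(_ tx).
  rewrite [(t - x) *: 1]mulr1 subrK ltr_distl mulrC => /andP[_ /ltW].
  by rewrite -[_ *: _]/(_ * _); clear - l0; lra.
have Hz : - e * (z - x) <= F z - F x.
  have [->|zx] := eqVneq z x; first by rewrite !subrr mulr0.
  have zx0 : 0 < z - x by rewrite subr_gt0 lt_def zx.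
  by rewrite -ler_pdivlMr// Hx// gtr0_norm// ltrBlDl.
have Hy : - e * (x - y) <= F x - F y.
  have [->|yx'] := eqVneq y x; first by rewrite !subrr mulr0.
  have yx0 : 0 < x - y by rewrite subr_gt0 lt_def eq_sym yx'.
  rewrite -ler_pdivlMr// -[F x - F y]opprB -[x - y]opprB invrN mulrNN.
  by rewrite Hx// distrC gtr0_norm// ltrBlDl -ltrBlDr.
by clear - Hz Hy; lra.
Qed.

End AbsolutelyContinuous.

(** * Calculus of absolutely continuous functions with a given derivative almost everywhere *)

Section AbsContAlgebra.
Variable R : realType.
Notation mu := (@lebesgue_measure R).

(** Sums, products and coordinates are handled by dominating the increments of [h] by those of [f]
    and [g]. *)
Lemma abs_cont01_lip (U V W : normedModType R) (f : R -> V) (g : R -> W)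
    (h : R -> U) (K : R) :
  abs_cont01 f -> abs_cont01 g ->
  (forall a b, 0 <= a -> a <= b -> b <= 1 ->
    `|h b - h a| <= K * (`|f b - f a| + `|g b - g a|)) ->
  abs_cont01 h.
Proof.
move=> acf acg H e e0.
have K0 : 0 < `|K| + 1 by rewrite ltr_wpDl.
have e2 : 0 < e / 2 / (`|K| + 1) by rewrite !divr_gt0.
have [d1 d10 H1] := acf _ e2; have [d2 d20 H2] := acg _ e2.
exists (Num.min d1 d2); first by rewrite lt_min d10.
move=> k a b ab dis; rewrite lt_min => /andP[s1 s2].
have {}H1 := H1 _ _ _ ab dis s1; have {}H2 := H2 _ _ _ ab dis s2.
apply: (@le_lt_trans _ _ ((`|K| + 1) *
    (\sum_(i < k) `|f (b i) - f (a i)| + \sum_(i < k) `|g (b i) - g (a i)|))).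
  rewrite -big_split mulr_sumr/=; apply: ler_sum => i _.
  have [? [? ?]] := ab i; apply: le_trans (H _ _ _ _ _) _ => //.
  by apply: ler_wpM2r; [rewrite addr_ge0|have := ler_norm K; lra].
have -> : e = (`|K| + 1) * (e / 2 / (`|K| + 1) + e / 2 / (`|K| + 1)).
  by field; rewrite gt_eqF.
by rewrite ltr_pM2l// ltrD.
Qed.

Lemma abs_cont01_cst (V : normedModType R) (c : V) : abs_cont01 (fun _ : R => c).
Proof.
move=> e e0; exists 1 => // k a b _ _ _.
by rewrite big1// => i _; rewrite subrr normr0.
Qed.

Lemma abs_cont01_id : abs_cont01 (fun t : R => t : R).
Proof.
move=> e e0; exists e => // k a b ab _; apply: le_lt_trans.
by apply: ler_sum => i _; have [_ [? _]] := ab i; rewrite ger0_norm// subr_ge0.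
Qed.

Lemma abs_cont01_uc (V : normedModType R) (f : R -> V) (e : R) : abs_cont01 f ->
  0 < e -> exists2 d : R, 0 < d & forall x y : R, 0 <= x <= 1 -> 0 <= y <= 1 ->
    `|x - y| < d -> `|f x - f y| < e.
Proof.
move=> acf e0; have [d d0 H] := acf _ e0; exists d => // x y.
wlog xy : x y / y <= x.
  move=> wl x1 y1 d1; have [yx|/ltW yx] := leP y x; first exact: wl.
  by rewrite distrC; apply: wl => //; rewrite distrC.
move=> /andP[x0 x1] /andP[y0 y1] xyd.
have := H 1%N (fun=> y) (fun=> x); rewrite !big_ord1; apply => //.
- by move=> i j; rewrite !ord1 eqxx.
- by rewrite -(ger0_norm (x := x - y))// subr_ge0.
Qed.

Lemma abs_cont01_continuous (V : normedModType R) (f : R -> V) :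
  abs_cont01 f -> {within `[0%R, 1%R], continuous f}.
Proof.
move=> acf; apply/subspace_continuousP => x /=; rewrite in_itv/= => x01.
apply/cvgrPdist_lt => e e0; have [d d0 H] := abs_cont01_uc acf e0.
rewrite near_withinE; apply/nbhs_ballP; exists d => // y xy.
by rewrite /= in_itv/= => y01; apply: H.
Qed.

Lemma abs_cont01_bounded (V : normedModType R) (f : R -> V) :
  abs_cont01 f -> exists K : R, forall t, 0 <= t <= 1 -> `|f t| <= K.
Proof.
move=> /abs_cont01_continuous /continuous_compact.
move=> /(_ (segment_compact (a := 0) (b := 1))) /compact_bounded[M [Mr HM]].
by exists (M + 1) => t t01; apply: HM; rewrite ?ltrDl//.
Qed.

Lemma abs_cont01D (V : normedModType R) (f g : R -> V) :
  abs_cont01 f -> abs_cont01 g -> abs_cont01 (fun t => f t + g t).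
Proof.
move=> af ag; apply: (abs_cont01_lip (K := 1) af ag) => a b _ _ _.
by rewrite mul1r opprD addrACA ler_normD.
Qed.

Lemma abs_cont01M (f g : R -> R) :
  abs_cont01 f -> abs_cont01 g -> abs_cont01 (fun t => f t * g t).
Proof.
move=> af ag.
have [K1 H1] := abs_cont01_bounded af; have [K2 H2] := abs_cont01_bounded ag.
apply: (abs_cont01_lip (K := K1 + K2) af ag) => a b a0 ab b1.
have -> : f b * g b - f a * g a = g b * (f b - f a) + f a * (g b - g a) by ring.
have b01 : 0 <= b <= 1 by lra.
have a01 : 0 <= a <= 1 by lra.
apply: le_trans (ler_normD _ _) _; rewrite !normrM.
have h1 := H1 _ a01; have h2 := H2 _ b01.
have n1 := normr_ge0 (f a); have n2 := normr_ge0 (g b).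
have n3 := normr_ge0 (f b - f a); have n4 := normr_ge0 (g b - g a).
nra.
Qed.

Lemma abs_cont01_sum (V : normedModType R) (I : Type) (r : seq I) (f : I -> R -> V) :
  (forall i, abs_cont01 (f i)) -> abs_cont01 (fun t => \sum_(i <- r) f i t).
Proof.
move=> H; elim: r => [|i r IH].
  rewrite [X in abs_cont01 X](_ : _ = fun=> 0); first exact: abs_cont01_cst.
  by apply/funext => t; rewrite big_nil.
rewrite [X in abs_cont01 X](_ : _ = fun t => f i t + \sum_(i <- r) f i t).
  exact: abs_cont01D.
by apply/funext => t; rewrite big_cons.
Qed.

Lemma abs_cont01_mxP m n (f : R -> 'M[R]_(m, n)) :
  abs_cont01 f <-> forall i j, abs_cont01 (fun t => f t i j).
Proof.
split=> [af i j|H].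
  apply: (abs_cont01_lip (K := 1) af af) => a b _ _ _; rewrite mul1r.
  apply: ler_wpDl => //; rewrite [leRHS]/Num.Def.normr/= mx_normrE.
  by have := @le_bigmax _ _ _ 0 (fun k => `|(f b - f a) k.1 k.2|) (i, j); rewrite /= !mxE.
have H1 i j : abs_cont01 (fun t => f t i j *: (delta_mx i j : 'M[R]_(m, n))).
  apply: (abs_cont01_lip (K := `|delta_mx i j : 'M[R]_(m, n)|) (H i j) (H i j)) => a b _ _ _.
  rewrite -scalerBl normrZ mulrC; apply: ler_wpM2l => //.
  by rewrite lerDl.
have -> : f = fun t => \sum_i \sum_j f t i j *: (delta_mx i j : 'M[R]_(m, n)).
  by apply/funext => t; exact: matrix_sum_delta.
by apply: abs_cont01_sum => i; apply: abs_cont01_sum => j; exact: H1.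
Qed.

Lemma ae_imply (P Q : R -> Prop) : (forall t, P t -> Q t) ->
  {ae mu, forall t, P t} -> {ae mu, forall t, Q t}.
Proof. by move=> PQ; apply: filterS; first exact: (ae_filter_ringOfSetsType mu). Qed.

Lemma ae_imply2 (P Q S : R -> Prop) : (forall t, P t -> Q t -> S t) ->
  {ae mu, forall t, P t} -> {ae mu, forall t, Q t} -> {ae mu, forall t, S t}.
Proof. by move=> PQ; apply: filterS2; first exact: (ae_filter_ringOfSetsType mu). Qed.

(** [phi] is the derivative only almost everywhere; absolute continuity makes it nevertheless
    determine the increments of [f], as in [ac_deriv_le] and [ac_deriv_eq]. *)
Definition ac_deriv (f phi : R -> R) : Prop := abs_cont01 f /\
  {ae mu, forall t : R, t \in `[0, 1] -> is_derive t (1 : R) f (phi t)}.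

Lemma ac_deriv_cst (c : R) : ac_deriv (fun=> c) (fun=> 0).
Proof. by split; [exact: abs_cont01_cst|apply: aeW => t _; exact: is_derive_cst]. Qed.

Lemma ac_deriv_id : ac_deriv (fun t => t) (fun=> 1).
Proof. by split; [exact: abs_cont01_id|apply: aeW => t _; exact: is_derive_id]. Qed.

Lemma ac_derivD f g phi psi : ac_deriv f phi -> ac_deriv g psi ->
  ac_deriv (fun t => f t + g t) (fun t => phi t + psi t).
Proof.
move=> [af df] [ag dg]; split; first exact: abs_cont01D.
apply: ae_imply2 df dg => t + + t01 => /(_ t01) ? /(_ t01) ?.
exact: is_deriveD.
Qed.

Lemma ac_derivM f g phi psi : ac_deriv f phi -> ac_deriv g psi ->
  ac_deriv (fun t => f t * g t) (fun t => phi t * g t + f t * psi t).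
Proof.
move=> [af df] [ag dg]; split; first exact: abs_cont01M.
apply: ae_imply2 df dg => t + + t01 => /(_ t01) dft /(_ t01) dgt.
apply: (is_derive_eq (is_deriveM dft dgt)).
by rewrite -[_ *: _]/(_ * _) -[g t *: _]/(_ * _); ring.
Qed.

Lemma ac_deriv_ext f phi g psi : ac_deriv f phi -> f =1 g -> phi =1 psi -> ac_deriv g psi.
Proof. by move=> h /funext <- /funext <-. Qed.

Lemma ac_derivZ c f phi : ac_deriv f phi ->
  ac_deriv (fun t => c * f t) (fun t => c * phi t).
Proof.
move=> h; apply: ac_deriv_ext (ac_derivM (ac_deriv_cst c) h) _ _ => // t.
by rewrite mul0r add0r.
Qed.

Lemma ac_derivB f g phi psi : ac_deriv f phi -> ac_deriv g psi ->
  ac_deriv (fun t => f t - g t) (fun t => phi t - psi t).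
Proof.
move=> hf /(ac_derivZ (-1)) hg; apply: ac_deriv_ext (ac_derivD hf hg) _ _ => t.
- by rewrite mulN1r.
- by rewrite mulN1r.
Qed.

Lemma ac_deriv_sum (I : Type) (r : seq I) (P : pred I) (f phi : I -> R -> R) :
  (forall i, P i -> ac_deriv (f i) (phi i)) ->
  ac_deriv (fun t => \sum_(i <- r | P i) f i t) (fun t => \sum_(i <- r | P i) phi i t).
Proof.
move=> H; elim: r => [|i r IH].
  by apply: ac_deriv_ext (ac_deriv_cst 0) _ _ => t; rewrite big_nil.
have [Pi|nPi] := boolP (P i).
  by apply: ac_deriv_ext (ac_derivD (H _ Pi) IH) _ _ => t; rewrite big_cons Pi.
by apply: ac_deriv_ext IH _ _ => t; rewrite big_cons (negbTE nPi).
Qed.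

Lemma ac_deriv_le f g phi psi (a b : R) : ac_deriv f phi -> ac_deriv g psi ->
  (forall t, 0 <= t <= 1 -> phi t <= psi t) ->
  0 <= a -> a <= b -> b <= 1 -> f b - f a <= g b - g a.
Proof.
move=> hf hg H a0 ab b1; have [ac dr] := ac_derivB hg hf.
have : g a - f a <= g b - f b.
  apply: (abs_cont01_le ac) => //; apply: ae_imply dr => t + t01 => /(_ t01) ?.
  exists (psi t - phi t) => //; rewrite subr_ge0; apply: H.
  by move: t01; rewrite in_itv.
lra.
Qed.

Lemma ac_deriv_norm_le f g phi psi (a b : R) : ac_deriv f phi -> ac_deriv g psi ->
  (forall t, 0 <= t <= 1 -> `|phi t| <= psi t) ->
  0 <= a -> a <= b -> b <= 1 -> `|f b - f a| <= g b - g a.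
Proof.
move=> hf hg H a0 ab b1; rewrite ler_norml; apply/andP; split; last first.
  by apply: (ac_deriv_le hf hg) => // t /H; exact: le_trans (ler_norm _).
have := ac_deriv_le (ac_derivZ (-1) hf) hg _ a0 ab b1.
move=> /(_ _)/wrap[] => [t /H|]; last lra.
by rewrite mulN1r; apply: le_trans; rewrite -normrN ler_norm.
Qed.

Lemma ac_deriv_eq f g phi (a b : R) : ac_deriv f phi -> ac_deriv g phi ->
  0 <= a -> a <= b -> b <= 1 -> f b - f a = g b - g a.
Proof.
move=> hf hg a0 ab b1; apply/le_anti/andP; split.
- exact: (ac_deriv_le hf hg).
- exact: (ac_deriv_le hg hf).
Qed.

Definition integrable01 (f : R -> R) := mu.-integrable `[0, 1] (EFin \o f).

(** Extending [f] by zero outside [[0, 1]] makes it integrable on the whole line as soon as it is on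
    [[0, 1]]. *)
Definition prim (f : R -> R) (t : R) : R :=
  \int[mu]_(x in `[0, t]) (f \_ `[0%R, 1%R]) x.

Lemma prim0 f : prim f 0 = 0.
Proof. by rewrite /prim set_itv1 Rintegral_set1. Qed.

Lemma prim1 f : prim f 1 = \int[mu]_(x in `[0, 1]) f x.
Proof. by apply: eq_Rintegral => x x01; rewrite patchE x01. Qed.

Lemma integrable01_restrict f : integrable01 f ->
  mu.-integrable setT (EFin \o (f \_ `[0%R, 1%R])).
Proof. by rewrite /integrable01 integrable_mkcond// restrict_EFin. Qed.

Lemma prim_sub f (a b : R) : integrable01 f -> 0 <= a -> a <= b ->
  prim f b - prim f a = \int[mu]_(x in `]a, b]) (f \_ `[0%R, 1%R]) x.
Proof.
move=> /integrable01_restrict intf a0 ab; rewrite /prim Rintegral_itvB//.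
exact: integrableS intf.
Qed.

Lemma abs_cont01_prim f : integrable01 f -> abs_cont01 (prim f).
Proof.
move=> /[dup] intf /integrable01_restrict intg e e0.
have [d [d0 H]] := integral_normr_continuous intg e0.
exists d => // k a b ab dis sd.
(* Half-open intervals are disjoint even when they share an end point. *)
pose I (i : 'I_k) : set R := `]a i, b i]%classic.
have tI : trivIset setT I.
  move=> i j _ _ [x []]; rewrite /I /= !in_itv/= => /andP[ai bi] /andP[aj bj].
  apply: contrapT => /eqP ij; have [] := dis i j ij; lra.
have mI i : measurable (I i) by exact: measurable_itv.
apply: le_lt_trans (H (\big[setU/set0]_(i < k) I i) _ _); last 2 first.
- by apply: bigsetU_measurable => i _; exact: mI.
- rewrite measure_bigsetU_ord//; apply: le_lt_trans (_ : _ <= (\sum_(i < k) (b i - a i))%:E)%E _.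
    rewrite -sumEFin; apply: lee_sum => i _; rewrite [leLHS]lebesgue_measure_itv/=.
    have [_ [? _]] := ab i.
    by case: ifP => // _; rewrite lee_fin subr_ge0.
  by rewrite lte_fin.
rewrite /Rintegral.
rewrite (integral_bigsetU_EFin mu mI)//; last 3 first.
- exact: index_enum_uniq.
- exact: sub_trivIset tI.
- apply/measurable_EFinP; apply: measurableT_comp => //.
  apply: measurable_funTS.
  by move/integrableP : intg => -[/measurable_EFinP].
have iI i : mu.-integrable (I i) (EFin \o (f \_ `[0%R, 1%R])).
  by apply: (integrableS _ _ _ intg) => //; exact: mI.
rewrite -sum_fine; last first.
  move=> i _; apply: integrable_fin_num; first exact: mI.
  exact: (integrable_norm (iI i)).
apply: ler_sum => i _; have [? [? ?]] := ab i.
by rewrite prim_sub//; apply: le_normr_Rintegral; [exact: mI|exact: iI].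
Qed.

Lemma ac_deriv_prim f : integrable01 f -> ac_deriv (prim f) f.
Proof.
move=> /[dup] intf /integrable01_restrict intg; split.
  exact: abs_cont01_prim.
have := @FTC1 R (f \_ `[0%R, 1%R]) (BLeft 0) _ _.
move=> /(_ _ _)/wrap[].
- by move=> y; exact: integrableS intg.
- by apply: integrable_locally => //; exact: intf.
(* [FTC1] is applied at points above the lower end [0], which is discarded as a null set. *)
have n0 : {ae mu, forall x : R, x <> 0}.
  exists [set 0]; split => //; first exact: lebesgue_measure_set1.
  by move=> x /= /contrapT.
move=> hF; apply: ae_imply2 hF n0 => x /= + /eqP x0 x01; rewrite in_itv/= in x01.
rewrite lte_fin lt_def x0 => /(_ (andP x01).1)[dx Ex].
have fx : (f \_ `[0%R, 1%R]) x = f x by rewrite patchE mem_set// /= in_itv.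
by apply: DeriveDef; [exact: dx|rewrite -derive1E; exact: etrans Ex fx].
Qed.

Lemma integrable01M (f g : R -> R) : abs_cont01 f -> integrable01 g ->
  integrable01 (fun t => f t * g t).
Proof.
move=> acf ig; apply: (@integrableMr _ _ _ mu _ _ f (EFin \o g)) => //.
- by apply: subspace_continuous_measurable_fun => //; exact: abs_cont01_continuous.
- have [K HK] := abs_cont01_bounded acf.
  exists K; split; first exact: num_real.
  move=> x Kx t /=; rewrite in_itv/= => t01.
  by apply: le_trans (HK _ t01) _; exact: ltW.
Qed.

Lemma prim_ge0 (f : R -> R) (t : R) : (forall x, 0 <= x <= 1 -> 0 <= f x) -> 0 <= prim f t.
Proof.
move=> H; apply: Rintegral_ge0 => x _; rewrite patchE; case: ifPn => // /set_mem.
by rewrite /= in_itv/= => /H.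
Qed.

End AbsContAlgebra.

(** * The sup norm of matrices, and compactness in finite dimension *)

Section MatrixNorm.
Variable R : realType.

Lemma mx_coord_le m n (A : 'M[R]_(m, n)) i j : `|A i j| <= `|A|.
Proof.
rewrite [leRHS]/Num.Def.normr/= mx_normrE.
exact: (@le_bigmax _ _ _ 0 (fun k : 'I_m * 'I_n => `|A k.1 k.2|) (i, j)).
Qed.

Lemma mx_norm_le m n (A : 'M[R]_(m, n)) (c : R) : 0 <= c ->
  (forall i j, `|A i j| <= c) -> `|A| <= c.
Proof.
move=> c0 H; rewrite [leLHS]/Num.Def.normr/= mx_normrE.
by apply: bigmax_le => // -[i j] _; exact: H.
Qed.

Lemma continuous_sumr (T : topologicalType) (I : Type) (r : seq I) (f : I -> T -> R) :
  (forall i, continuous (f i)) -> continuous (fun t => \sum_(i <- r) f i t).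
Proof.
move=> H; elim: r => [|i r IH].
  rewrite [X in continuous X](_ : _ = fun=> 0); first exact: cst_continuous.
  by apply/funext => t; rewrite big_nil.
rewrite [X in continuous X](_ : _ = fun t => f i t + \sum_(i <- r) f i t).
  by move=> t; apply: cvgD; [exact: H|exact: IH].
by apply/funext => t; rewrite big_cons.
Qed.

Lemma compact_pos_lb (T : topologicalType) (S : set T) (q : T -> R) :
  compact S -> continuous q -> (forall z, S z -> 0 < q z) ->
  exists2 c : R, 0 < c & forall z, S z -> c <= q z.
Proof.
(* The empty case can occur: the unit sphere of a zero-dimensional space. *)
move=> cS cq qpos; have [S0|/nonemptyPn S0] := pselect (S !=set0); last first.
  by exists 1 => // z; rewrite S0.
have [|c cS' cmin] := compact_EVT_min (f := q) S0 cS.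
  exact: continuous_subspaceT.
exists (q c); first by apply: qpos; rewrite inE in cS'.
by move=> z Sz; apply: cmin; rewrite inE.
Qed.

Lemma compact_sphere n : compact [set x : 'rV[R]_n | `|x| = 1].
Proof.
apply: bounded_closed_compact.
  by exists 1; split=> // M M1 x /= ->; exact: ltW.
apply: (@closed_comp _ _ (fun x : 'rV[R]_n => `|x|) [set 1]).
  by move=> x _; exact: norm_continuous.
exact: closed_eq.
Qed.

End MatrixNorm.

(** * The bracket as a skew bilinear map, and a quantitative form of fatness *)

Section Bilinear.
Variables (R : realType) (m n2 : nat).
Variable B : 'rV[R]_m -> 'rV[R]_m -> 'rV[R]_n2.
Hypothesis Bsk : skew_bilinear B.

Lemma BDl x x' y : B (x + x') y = B x y + B x' y.
Proof. by have := Bsk.1 1 x x' y; rewrite !scale1r. Qed.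

Lemma B0l y : B 0 y = 0.
Proof.
have := BDl 0 0 y; rewrite addr0 => /(congr1 (fun z => z - B 0 y)).
by rewrite addrK subrr.
Qed.

Lemma BZl a x y : B (a *: x) y = a *: B x y.
Proof. by have := Bsk.1 a x 0 y; rewrite B0l !addr0. Qed.

Lemma BC x y : B x y = - B y x. Proof. exact: Bsk.2. Qed.

Lemma BDr x y y' : B x (y + y') = B x y + B x y'.
Proof. by rewrite BC BDl opprD -!(BC x). Qed.

Lemma BZr a x y : B x (a *: y) = a *: B x y.
Proof. by rewrite BC BZl -scalerN -BC. Qed.

Lemma Bxx x : B x x = 0.
Proof.
apply/eqP; have /eqP := BC x x; rewrite -subr_eq0 opprK -mulr2n -scaler_nat.
by rewrite scaler_eq0 pnatr_eq0.
Qed.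

Lemma BNl x y : B (- x) y = - B x y.
Proof. by rewrite -scaleN1r BZl scaleN1r. Qed.

Lemma BNr x y : B x (- y) = - B x y.
Proof. by rewrite -scaleN1r BZr scaleN1r. Qed.

Lemma B_suml (I : finType) (x : I -> 'rV[R]_m) y :
  B (\sum_i x i) y = \sum_i B (x i) y.
Proof. by apply: (big_morph (fun x => B x y)) => [? ?|]; [exact: BDl|exact: B0l]. Qed.

Lemma B_sumr (I : finType) x (y : I -> 'rV[R]_m) :
  B x (\sum_i y i) = \sum_i B x (y i).
Proof. by rewrite BC B_suml -sumrN; apply: eq_bigr => i _; rewrite -BC. Qed.

Definition Bcoef i j k : R := B (delta_mx 0 i) (delta_mx 0 j) 0 k.

Lemma B_coord x y k : B x y 0 k = \sum_i \sum_j Bcoef i j k * (x 0 i * y 0 j).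
Proof.
rewrite [x in LHS]row_sum_delta B_suml summxE; apply: eq_bigr => i _.
rewrite [y in LHS]row_sum_delta B_sumr summxE; apply: eq_bigr => j _.
by rewrite BZl BZr !mxE /Bcoef; ring.
Qed.

Definition Bbound : R := \sum_i \sum_j \sum_k `|Bcoef i j k|.

Lemma Bbound_ge0 : 0 <= Bbound.
Proof. by do 3![apply: sumr_ge0 => ? _]. Qed.

Lemma B_bound_coord (x y : 'rV[R]_m) (a b : R) k : (forall i, `|x 0 i| <= a) ->
  (forall i, `|y 0 i| <= b) -> `|B x y 0 k| <= Bbound * (a * b).
Proof.
move=> xa yb; rewrite B_coord; apply: le_trans (ler_norm_sum _ _ _) _.
rewrite /Bbound mulr_suml; apply: ler_sum => i _.
apply: le_trans (ler_norm_sum _ _ _) _; rewrite mulr_suml; apply: ler_sum => j _.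
rewrite !normrM; apply: ler_pM => //; last by apply: ler_pM.
by rewrite (bigD1 k)//= lerDl sumr_ge0.
Qed.

Lemma B_bound (x y : 'rV[R]_m) : `|B x y| <= Bbound * (`|x| * `|y|).
Proof.
apply: mx_norm_le => [|i k]; first by rewrite !mulr_ge0// Bbound_ge0.
by rewrite (ord1 i); apply: B_bound_coord => j; exact: mx_coord_le.
Qed.

Hypothesis Bfat : fat B.

Lemma fat_surj (x : 'rV[R]_m) (z : 'rV[R]_n2) : x != 0 -> exists y, B x y = z.
Proof.
move=> /eqP x0.
have [||Y1 [Y2 [Y10 [Y20]]]] := Bfat (X := (x, 0)) _ _ (0, z) => //.
  by move=> [].
(* The factor 2 comes from the bracket, the sign from skew-symmetry. *)
move=> [_ /= E]; exists (- (2 *: Y2.1)).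
rewrite BNr BZr -scalerN -BC E.
by move: Y10; rewrite /in_g1 => ->; rewrite add0r.
Qed.

Let A (x : 'rV[R]_m) : 'M[R]_(m, n2) := \matrix_j B x (delta_mx 0 j).

Let AE (x y : 'rV[R]_m) : y *m A x = B x y.
Proof.
rewrite [y in RHS]row_sum_delta B_sumr mulmx_sum_row; apply: eq_bigr => j _.
by rewrite BZr rowK.
Qed.

(** At [z = (x, l)] this is the squared Euclidean norm of [l *m (A x)^T], written as a polynomial in
    the coordinates of both arguments so that joint continuity is visible. *)
Let q (z : 'rV[R]_m * 'rV[R]_n2) : R :=
  \sum_j (\sum_k (\sum_i z.1 0 i * Bcoef i j k) * z.2 0 k) ^+ 2.

Let qE (x : 'rV[R]_m) (l : 'rV[R]_n2) : q (x, l) = \sum_j ((l *m (A x)^T) 0 j) ^+ 2.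
Proof.
apply: eq_bigr => j _; congr (_ ^+ 2); rewrite mxE; apply: eq_bigr => k _.
rewrite !mxE mulrC /=; congr (_ * _).
rewrite [x in RHS]row_sum_delta B_suml summxE; apply: eq_bigr => i _.
by rewrite BZl mxE.
Qed.

Let q_mx (x : 'rV[R]_m) (l : 'rV[R]_n2) : (q (x, l))%:M = l *m ((A x)^T *m A x) *m l^T.
Proof.
have -> : l *m ((A x)^T *m A x) *m l^T = (l *m (A x)^T) *m (l *m (A x)^T)^T.
  by rewrite trmx_mul trmxK !mulmxA.
rewrite qE; apply/matrixP => i j; rewrite !ord1 mxE eqxx mulr1n [RHS]mxE.
by apply: eq_bigr => k _; rewrite [X in _ * X]mxE expr2.
Qed.

Let q_scale (a b : R) (x : 'rV[R]_m) (l : 'rV[R]_n2) :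
  q (a *: x, b *: l) = (a * b) ^+ 2 * q (x, l).
Proof.
rewrite !qE mulr_sumr; apply: eq_bigr => j _; rewrite -exprMn; congr (_ ^+ 2).
have -> : A (a *: x) = a *: A x by apply/matrixP => i k; rewrite !mxE BZl mxE.
by rewrite linearZ/= -scalemxAr -scalemxAl scalerA mxE.
Qed.

Let q_cont : continuous q.
Proof.
apply: continuous_sumr => j; move=> z.
apply: (@continuous_comp _ _ _ _ (fun x : R => x ^+ 2)); last exact: exprn_continuous.
move: z; apply: continuous_sumr => k z; apply: cvgM.
  move: z; apply: continuous_sumr => i z; apply: cvgMl.
  apply: (@continuous_comp _ _ _ fst (fun x : 'rV[R]_m => x 0 i)); first exact: cvg_fst.
  exact: coord_continuous.
apply: (@continuous_comp _ _ _ snd (fun x : 'rV[R]_n2 => x 0 k)); first exact: cvg_snd.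
exact: coord_continuous.
Qed.

(** [l] is orthogonal to the range of [A x], which is the whole space by fatness; hence [l] is
    orthogonal to itself. *)
Let q_eq0 (x : 'rV[R]_m) (l : 'rV[R]_n2) : x != 0 -> q (x, l) = 0 -> l = 0.
Proof.
move=> x0; rewrite qE => /eqP; rewrite psumr_eq0; last by move=> j _; exact: sqr_ge0.
move=> /allP H.
have lA : l *m (A x)^T = 0.
  apply/rowP => j; rewrite [RHS]mxE; apply/eqP; rewrite -sqrf_eq0.
  by apply: H; rewrite mem_index_enum.
have [y yE] := fat_surj l x0.
have E : l = y *m A x by rewrite AE.
have : l *m l^T = 0 by rewrite [X in trmx X]E trmx_mul mulmxA lA mul0mx.
move=> /(congr1 (fun M : 'M[R]_1 => M 0 0)); rewrite !mxE => /eqP.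
rewrite psumr_eq0; last by move=> j _; rewrite mxE -expr2 sqr_ge0.
move=> /allP L; apply/rowP => k; rewrite [RHS]mxE; apply/eqP.
by rewrite -sqrf_eq0 expr2; have := L k; rewrite mem_index_enum mxE; apply.
Qed.

(** [q] is bihomogeneous, and positive on the compact product of the unit spheres, hence bounded
    below uniformly. This bounds the least-norm solution [y]. *)
Lemma fat_bound : exists2 K : R, 0 <= K & forall (x : 'rV[R]_m) (z : 'rV[R]_n2), x != 0 ->
  exists2 y, B x y = z & `|x| * `|y| <= K * `|z|.
Proof.
have [c c0 cq] : exists2 c : R, 0 < c & forall x l, c * (`|x| ^+ 2 * `|l| ^+ 2) <= q (x, l).
  have [||c c0 H] := @compact_pos_lb R _
     ([set x : 'rV[R]_m | `|x| = 1] `*` [set x : 'rV[R]_n2 | `|x| = 1]) q _ q_cont.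
  - by apply: compact_setX; exact: compact_sphere.
  - move=> [x l] /= [x1 l1]; rewrite lt_def; apply/andP; split.
      apply/eqP => /q_eq0 l0; have : x != 0 by rewrite -normr_eq0 x1 oner_eq0.
      by move=> /l0 l00; move: l1; rewrite l00 normr0 => /esym/eqP; rewrite oner_eq0.
    by apply: sumr_ge0 => j _; exact: sqr_ge0.
  exists c => // x l.
  have [->|x0] := eqVneq x 0.
    rewrite normr0 expr0n mul0r mulr0; apply: sumr_ge0 => j _; exact: sqr_ge0.
  have [->|l0] := eqVneq l 0.
    rewrite normr0 expr0n !mulr0; apply: sumr_ge0 => j _; exact: sqr_ge0.
  have := H (`|x|^-1 *: x, `|l|^-1 *: l).
  rewrite /= !normrZ !normfV !normr_id !mulVf ?normr_eq0// => /(_ (conj erefl erefl)).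
  have -> : q (`|x|^-1 *: x, `|l|^-1 *: l) = q (x, l) / (`|x| ^+ 2 * `|l| ^+ 2).
    rewrite q_scale mulrC; congr (_ * _).
    by rewrite -invfM exprVn exprMn.
  by rewrite ler_pdivlMr// mulr_gt0// exprn_gt0// normr_gt0.
exists (n2%:R / Num.sqrt c) => [|x z x0]; first by rewrite divr_ge0// sqrtr_ge0.
set S := (A x)^T *m A x.
have Su : S \in unitmx.
  rewrite -row_free_unit; apply/inj_row_free => v vS; apply: (q_eq0 x0).
  by have := q_mx x v; rewrite vS mul0mx => /(congr1 (fun M : 'M[R]_1 => M 0 0));
    rewrite !mxE eqxx mulr1n.
(* The least-norm solution; the Gram matrix [S] is invertible by [q_eq0]. *)
pose l := z *m invmx S; pose y := l *m (A x)^T.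
have lS : l *m S = z by rewrite mulmxKV.
exists y; first by rewrite -AE -mulmxA.
have yq j : (y 0 j) ^+ 2 <= q (x, l).
  by rewrite qE (bigD1 j)//= lerDl sumr_ge0// => i _; exact: sqr_ge0.
have q0 : 0 <= q (x, l) by rewrite qE; apply: sumr_ge0 => j _; exact: sqr_ge0.
have yn : `|y| <= Num.sqrt (q (x, l)).
  apply: mx_norm_le => [|i j]; first exact: sqrtr_ge0.
  by rewrite ord1 -sqrtr_sqr ler_wsqrtr.
(* Since [l *m S = z], the value [q (x, l)] is the scalar product of [z] and [l]. *)
have ql : q (x, l) <= n2%:R * (`|z| * `|l|).
  have := q_mx x l; rewrite lS => /(congr1 (fun M : 'M[R]_1 => M 0 0)).
  rewrite !mxE eqxx mulr1n => ->.
  apply: le_trans (ler_norm _) _; apply: le_trans (ler_norm_sum _ _ _) _.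
  apply: (@le_trans _ _ (\sum_(k < n2) (`|z| * `|l|))).
    by apply: ler_sum => k _; rewrite [l^T _ _]mxE normrM;
       apply: ler_pM => //; exact: mx_coord_le.
  by rewrite sumr_const card_ord mulr_natl.
have cx := cq x l.
have x0' : 0 < `|x| by rewrite normr_gt0.
rewrite mulrAC ler_pdivlMr ?sqrtr_gt0//.
have sc : Num.sqrt c ^+ 2 = c by rewrite sqr_sqrtr// ltW.
have sq : Num.sqrt (q (x, l)) ^+ 2 = q (x, l) by rewrite sqr_sqrtr.
apply: (@le_trans _ _ (`|x| * Num.sqrt (q (x, l)) * Num.sqrt c)).
  by rewrite ler_wpM2r ?sqrtr_ge0// ler_wpM2l.
rewrite -ler_sqr ?nnegrE ?mulr_ge0 ?sqrtr_ge0//.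
rewrite !exprMn sc sq.
(* When [q (x, l)] is nonzero, both sides are multiplied by it: [cx] then eliminates [l] from the
   square of [ql]. *)
have [->|qn0] := eqVneq (q (x, l)) 0; first by rewrite !(mulr0, mul0r) !mulr_ge0 ?sqr_ge0.
have qp : 0 < q (x, l) by rewrite lt_def qn0.
rewrite -(ler_pM2r qp).
have h1 : q (x, l) ^+ 2 <= (n2%:R * (`|z| * `|l|)) ^+ 2.
  by rewrite ler_sqr ?nnegrE// !mulr_ge0.
have h2 : `|x| ^+ 2 * c * q (x, l) ^+ 2 <= `|x| ^+ 2 * c * (n2%:R * (`|z| * `|l|)) ^+ 2.
  by rewrite ler_wpM2l// mulr_ge0 ?sqr_ge0// ltW.
have h3 : (n2%:R * `|z|) ^+ 2 * (c * (`|x| ^+ 2 * `|l| ^+ 2)) <= (n2%:R * `|z|) ^+ 2 * q (x, l).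
  by rewrite ler_wpM2l// sqr_ge0.
move: h2 h3; rewrite !exprMn; nra.
Qed.

End Bilinear.

(** * Horizontal curves ending at the identity, and their lengths *)

Section Curves.
Variables (R : realType) (m n2 : nat).
Variable B : 'rV[R]_m -> 'rV[R]_m -> 'rV[R]_n2.
Hypothesis Bsk : skew_bilinear B.
Notation mu := (@lebesgue_measure R).

Lemma coord_le_enorm k (x : 'rV[R]_k) i : `|x 0 i| <= enorm x.
Proof.
rewrite -sqrtr_sqr ler_wsqrtr// (bigD1 i)//= lerDl.
by apply: sumr_ge0 => j _; exact: sqr_ge0.
Qed.

Lemma enorm_ge0 k (x : 'rV[R]_k) : 0 <= enorm x. Proof. exact: sqrtr_ge0. Qed.

Lemma enorm_sqr k (x : 'rV[R]_k) : enorm x ^+ 2 = \sum_i x 0 i ^+ 2.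
Proof. by rewrite sqr_sqrtr// sumr_ge0// => i _; exact: sqr_ge0. Qed.

Lemma norm_le_enorm k (x : 'rV[R]_k) : `|x| <= enorm x.
Proof.
by apply: mx_norm_le => [|i j]; [exact: enorm_ge0|rewrite ord1; exact: coord_le_enorm].
Qed.

Lemma measurable_enorm k (u : R -> 'rV[R]_k) (D : set R) :
  (forall i, measurable_fun D (fun t => u t 0 i)) ->
  measurable_fun D (fun t => enorm (u t)).
Proof.
move=> mu_; apply: measurableT_comp.
  by apply: continuous_measurable_fun; exact: sqrt_continuous.
by apply: measurable_sum => i; apply: measurable_funX.
Qed.

Lemma integrable01D (f g : R -> R) : integrable01 f -> integrable01 g ->
  integrable01 (fun t => f t + g t).
Proof. by move=> hf hg; exact: (@integrableD _ _ _ mu _ _ (EFin \o f) (EFin \o g)). Qed.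

Lemma integrable01Z (c : R) (f : R -> R) : integrable01 f -> integrable01 (fun t => c * f t).
Proof. by move=> hf; exact: (@integrableZl _ _ _ mu _ _ c _ hf). Qed.

Lemma integrable01_sum (I : Type) (r : seq I) (f : I -> R -> R) :
  (forall i, integrable01 (f i)) -> integrable01 (fun t => \sum_(i <- r) f i t).
Proof.
move=> H; elim: r => [|i r IH].
  rewrite [X in integrable01 X](_ : _ = fun=> 0); last by apply/funext => t; rewrite big_nil.
  exact: integrable0.
rewrite [X in integrable01 X](_ : _ = fun t => f i t + \sum_(i <- r) f i t).
  exact: integrable01D.
by apply/funext => t; rewrite big_cons.
Qed.

Lemma integrable01_le (f g : R -> R) : measurable_fun `[(0:R)%R, (1:R)%R] f ->
  (forall t, 0 <= t <= 1 -> `|f t| <= g t) -> integrable01 g -> integrable01 f.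
Proof.
move=> mf fg; apply: le_integrable => //; first exact/measurable_EFinP.
move=> t /=; rewrite in_itv/= => t01; rewrite lee_fin.
by apply: le_trans (fg _ t01) (ler_norm _).
Qed.

Definition vac_deriv n (f phi : R -> 'rV[R]_n) : Prop :=
  forall k, ac_deriv (fun t => f t 0 k) (fun t => phi t 0 k).

Lemma vac_derivP n (f phi : R -> 'rV[R]_n) : vac_deriv f phi <->
  abs_cont01 f /\ {ae mu, forall t : R, t \in `[0, 1] ->
    derivable f t 1 /\ derive1 f t = phi t}.
Proof.
split=> [H|[/abs_cont01_mxP af df] k].
  split; first by apply/abs_cont01_mxP => i j; rewrite ord1; exact: (H j).1.
  have : {ae mu, forall t : R, forall k, t \in `[0, 1] ->
      is_derive t (1 : R) (fun t => f t 0 k) (phi t 0 k)}.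
    by apply: filter_forall => k; exact: (H k).2.
  apply: ae_imply => t Ht t01.
  have dft : derivable f t 1.
    by apply/derivable_mxP => i j; rewrite ord1; have [] := Ht j t01.
  split=> //; rewrite derive1E derive_mx//; apply/rowP => k; rewrite mxE.
  by have ? := Ht k t01; rewrite derive_val.
split; first exact: af.
apply: ae_imply df => t + t01 => /(_ t01)[dft E]; split.
  by move/derivable_mxP : dft => /(_ 0 k).
by rewrite -E derive1E derive_mx// mxE.
Qed.

(** The curves of [cc_lengths] with end point [0], rephrased through [vac_deriv]. Finite length is
    kept apart, as integrability of the speed. *)
Definition curve (p : carnot_pt R m n2) (g1 : R -> 'rV[R]_m) (g2 : R -> 'rV[R]_n2)
    (u : R -> 'rV[R]_m) : Prop :=
  [/\ vac_deriv g1 u, vac_deriv g2 (fun t => B (g1 t) (u t)),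
      (forall i : 'I_m, measurable_fun `[(0:R)%R, (1:R)%R] (fun t => u t 0 i)),
      (g1 0, g2 0) = p & (g1 1 = 0 /\ g2 1 = 0)].

(** Any integrable majorant of the speed will do, so the exact length of a perturbed curve is never
    computed. *)
Lemma cc_dist_le p g1 g2 u (psi : R -> R) : curve p g1 g2 u -> integrable01 psi ->
  (forall t, 0 <= t <= 1 -> enorm (u t) <= psi t) ->
  (cc_dist B p 0%R <= (prim psi 1)%:E)%E.
Proof.
move=> [/vac_derivP[ac1 d1] /vac_derivP[ac2 d2] mu_ p0 [g11 g21]] ipsi upsi.
apply: (@le_trans _ _ (\int[mu]_(t in `[(0:R)%R, (1:R)%R]) (enorm (u t))%:E)%E).
  apply: ereal_inf_lbound; exists g1, g2, u; split=> //.
  - apply: ae_imply2 d1 d2 => t + + t01 => /(_ t01)[? ?] /(_ t01)[? ?].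
    by split.
  - by rewrite g11 g21.
rewrite prim1 /Rintegral fineK; last exact: integrable_fin_num.
apply: ge0_le_integral => //.
- by move=> t _; rewrite lee_fin enorm_ge0.
- by apply/measurable_EFinP; exact: measurable_enorm.
- by move/integrableP : ipsi => -[].
Qed.

Lemma cc_lengths_curve p l : cc_lengths B p 0 l -> (l < +oo)%E ->
  exists g1 g2 u, [/\ curve p g1 g2 u, integrable01 (fun t => enorm (u t)) &
    l = (prim (fun t => enorm (u t)) 1)%:E].
Proof.
move=> [g1 [g2 [u [[ac1 ac2] mu_ hor [p0 p1] ->]]]] lfin.
have iu : integrable01 (fun t => enorm (u t)).
  apply/integrableP; split; first by apply/measurable_EFinP; exact: measurable_enorm.
  under eq_integral do rewrite /= ger0_norm ?enorm_ge0//.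
  exact: lfin.
exists g1, g2, u; split => //; last first.
  by rewrite prim1 /Rintegral fineK//; exact: integrable_fin_num.
split=> //.
- apply/vac_derivP; split=> //; apply: ae_imply hor => t + t01 => /(_ t01)[].
  by split.
- apply/vac_derivP; split=> //; apply: ae_imply hor => t + t01 => /(_ t01)[].
  by split.
- by case: p1.
Qed.

Lemma cc_dist_ge0 p : (0 <= cc_dist B p 0%R)%E.
Proof.
apply: le_ereal_inf_tmp => l [g1 [g2 [u [_ _ _ _ ->]]]].
by apply: integral_ge0 => t _; rewrite lee_fin enorm_ge0.
Qed.

Lemma vac_derivD n (f g phi psi : R -> 'rV[R]_n) : vac_deriv f phi -> vac_deriv g psi ->
  vac_deriv (fun t => f t + g t) (fun t => phi t + psi t).
Proof.
move=> hf hg k; apply: ac_deriv_ext (ac_derivD (hf k) (hg k)) _ _ => t; by rewrite mxE.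
Qed.

Lemma vac_derivZ n (f phi : R -> 'rV[R]_n) (a b : R -> R) : ac_deriv a b ->
  vac_deriv f phi ->
  vac_deriv (fun t => a t *: f t) (fun t => b t *: f t + a t *: phi t).
Proof.
move=> hf hg k; apply: ac_deriv_ext (ac_derivM hf (hg k)) _ _ => t; by rewrite !mxE.
Qed.

Lemma vac_deriv_cst n (c : 'rV[R]_n) : vac_deriv (fun=> c) (fun=> 0).
Proof. by move=> k; apply: ac_deriv_ext (ac_deriv_cst _) _ _ => t //; rewrite mxE. Qed.

Lemma vac_deriv_ext n (f phi g psi : R -> 'rV[R]_n) : vac_deriv f phi ->
  f =1 g -> phi =1 psi -> vac_deriv g psi.
Proof. by move=> h /funext <- /funext <-. Qed.

Lemma vac_derivZc n (c : 'rV[R]_n) (a b : R -> R) : ac_deriv a b ->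
  vac_deriv (fun t => a t *: c) (fun t => b t *: c).
Proof.
move=> h; apply: vac_deriv_ext (vac_derivZ h (vac_deriv_cst c)) _ _ => t //.
by rewrite scaler0 addr0.
Qed.

Lemma vac_derivcZ n (c : R) (f phi : R -> 'rV[R]_n) : vac_deriv f phi ->
  vac_deriv (fun t => c *: f t) (fun t => c *: phi t).
Proof.
move=> h; apply: vac_deriv_ext (vac_derivZ (ac_deriv_cst c) h) _ _ => t //.
by rewrite scale0r add0r.
Qed.

Lemma vac_derivB (f g phi psi : R -> 'rV[R]_m) : vac_deriv f phi -> vac_deriv g psi ->
  vac_deriv (fun t => B (f t) (g t)) (fun t => B (phi t) (g t) + B (f t) (psi t)).
Proof.
move=> hf hg k; apply: ac_deriv_ext.
- exact: (ac_deriv_sum (index_enum _) (P := xpredT) (fun i _ =>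
    ac_deriv_sum (index_enum _) (P := xpredT) (fun j _ =>
    ac_derivZ (Bcoef B i j k) (ac_derivM (hf i) (hg j))))).
- by move=> t /=; rewrite B_coord.
- move=> t /=; rewrite mxE !B_coord// -big_split; apply: eq_bigr => i _ /=.
  by rewrite -big_split; apply: eq_bigr => j _ /=; rewrite mulrDr.
Qed.

End Curves.

(** Holds because [4 (x^2 + x y + y^2) - (x - y)^2 = 3 (x + y)^2]. It controls the increment of a
    function by that of its cube, whose derivative carries the squared function as a weight. *)
Lemma cube_diff (R : realFieldType) (x y : R) :
  `|x - y| ^+ 3 <= 4 * `|x ^+ 3 - y ^+ 3|.
Proof.
have -> : x ^+ 3 - y ^+ 3 = (x - y) * (x ^+ 2 + x * y + y ^+ 2) by ring.
have q : (x - y) ^+ 2 <= 4 * (x ^+ 2 + x * y + y ^+ 2).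
  by have := sqr_ge0 (x + y); lra.
have q0 : 0 <= x ^+ 2 + x * y + y ^+ 2 by have := sqr_ge0 (x - y); lra.
rewrite normrM (ger0_norm q0) exprS real_normK ?num_real//.
have := normr_ge0 (x - y); nra.
Qed.

(* By AM-GM, [2 s |u - s om| <= s^2 + |u - s om|^2]. *)
Lemma enorm_shift (R : realType) m (u om : 'rV[R]_m) :
  enorm (u - enorm u *: om) <=
    enorm u - \sum_k u 0 k * om 0 k + enorm u / 2 * \sum_k om 0 k ^+ 2.
Proof.
set s := enorm u; set x := \sum_k _ * _; set w := \sum_k _.
have s0 : 0 <= s := enorm_ge0 u.
have := enorm_sqr (u - s *: om).
have -> : \sum_i (u - s *: om) 0 i ^+ 2 = s ^+ 2 - 2 * s * x + s ^+ 2 * w.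
  rewrite {1}[s ^+ 2]enorm_sqr /x /w !mulr_sumr -sumrB -big_split; apply: eq_bigr => i _ /=.
  by rewrite !mxE; ring.
have e0 := enorm_ge0 (u - s *: om).
set e := enorm _ in e0 * => eE.
have [s00|s_neq0] := eqVneq s 0.
  have x0 : x = 0.
    rewrite /x big1// => i _; have := coord_le_enorm u i; rewrite -/s s00.
    by rewrite normr_le0 => /eqP ->; rewrite mul0r.
  by move: eE; rewrite s00 x0 => eE; nra.
have sp : 0 < s by rewrite lt_def s_neq0.
rewrite -(ler_pM2l sp); have := sqr_ge0 (s - e); lra.
Qed.

(** * Perturbation of a curve by controls weighted with its speed *)

Section Perturbation.
Variables (R : realType) (m n2 : nat).
Variable B : 'rV[R]_m -> 'rV[R]_m -> 'rV[R]_n2.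
Hypothesis Bsk : skew_bilinear B.
Variables (p : carnot_pt R m n2) (g1 : R -> 'rV[R]_m) (g2 : R -> 'rV[R]_n2).
Variable u : R -> 'rV[R]_m.
Hypothesis Hc : curve B p g1 g2 u.
Hypothesis iu : integrable01 (fun t => enorm (u t)).

Let s t := enorm (u t).
Let L := prim s.
Let l := L 1.
Hypothesis l0 : 0 < l.

Let dL : ac_deriv L s. Proof. exact: ac_deriv_prim. Qed.
Let s0 t : 0 <= s t. Proof. exact: enorm_ge0. Qed.
Let d1 : vac_deriv g1 u. Proof. by have [] := Hc. Qed.
Let d2 : vac_deriv g2 (fun t => B (g1 t) (u t)). Proof. by have [] := Hc. Qed.
Let uk k t : `|u t 0 k| <= s t. Proof. exact: coord_le_enorm. Qed.
Let g10 : g1 0 = p.1. Proof. by have [_ _ _ <- _] := Hc. Qed.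
Let g20 : g2 0 = p.2. Proof. by have [_ _ _ <- _] := Hc. Qed.
Let g11 : g1 1 = 0. Proof. by have [_ _ _ _ []] := Hc. Qed.
Let g21 : g2 1 = 0. Proof. by have [_ _ _ _ []] := Hc. Qed.
Let L0 : L 0 = 0. Proof. exact: prim0. Qed.

(** The rest of the curve leads to [0], so its length bounds the coordinate. *)
Lemma curve_coord_le k t : 0 <= t <= 1 -> `|g1 t 0 k| <= l.
Proof.
move=> /andP[t0 t1].
have := ac_deriv_norm_le (d1 k) dL (fun x _ => uk k x) t0 t1 (lexx 1).
rewrite g11 mxE sub0r normrN => /le_trans; apply.
by rewrite lerBlDr lerDl; apply: prim_ge0.
Qed.

Lemma curve_end2_le d k : 0 <= d -> (forall j t, 0 <= t <= 1 -> `|g1 t 0 j| <= d) ->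
  `|p.2 0 k| <= Bbound B * (d * l).
Proof.
move=> d0 H.
have := ac_deriv_norm_le (d2 k) (ac_derivZ (Bbound B * d) dL) _ (lexx 0) ler01 (lexx 1).
rewrite g21 g20 mxE sub0r normrN L0 mulr0 subr0 -mulrA; apply => t t01.
by rewrite -mulrA; apply: B_bound_coord => // j; exact: H.
Qed.

Variable i : 'I_m.

Let ig (f : R -> R) : abs_cont01 f -> integrable01 (fun t => f t * s t).
Proof. by move=> af; exact: integrable01M. Qed.

(** The mean of [g1] for the arc length measure; centring with it makes [Th] vanish at both ends. *)
Let gb : 'rV[R]_m := \row_k (prim (fun t => g1 t 0 k * s t) 1 / l).
Let th t := g1 t 0 i - gb 0 i.
Let Th := prim (fun t => th t * s t).
Let H0 t : 'rV[R]_m := \row_k prim (fun x => g1 x 0 k * s x) t.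
Let H t : 'rV[R]_m := \row_k prim (fun x => (g1 x 0 k * th x) * s x) t.
Let C t := 1 - l^-1 * L t.
(** For the displacement [V] introduced below, with derivative [V'], the quantity [B V V'] is the
    derivative of [K] times [B h a]. *)
Let K := prim (fun t => (- l^-1 * Th t - C t * th t) * s t).

Let ac_g k : abs_cont01 (fun t => g1 t 0 k). Proof. exact: (d1 k).1. Qed.
Let d_th : ac_deriv th (fun t => u t 0 i).
Proof.
apply: ac_deriv_ext (ac_derivB (d1 i) (ac_deriv_cst (gb 0 i))) _ _ => t //.
by rewrite subr0.
Qed.
Let d_Th : ac_deriv Th (fun t => th t * s t).
Proof. by apply: ac_deriv_prim; apply: ig; exact: d_th.1. Qed.
Let d_H0 : vac_deriv H0 (fun t => s t *: g1 t).
Proof.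
move=> k; apply: ac_deriv_ext (ac_deriv_prim (ig (ac_g k))) _ _ => t; rewrite mxE//.
exact: mulrC.
Qed.
Let d_H : vac_deriv H (fun t => (s t * th t) *: g1 t).
Proof.
move=> k; have := ac_deriv_prim (ig (abs_cont01M (ac_g k) d_th.1)).
by move=> /ac_deriv_ext; apply => t; rewrite mxE//; ring.
Qed.
Let d_C : ac_deriv C (fun t => - l^-1 * s t).
Proof.
apply: ac_deriv_ext (ac_derivB (ac_deriv_cst 1) (ac_derivZ l^-1 dL)) _ _ => t //.
by rewrite sub0r mulNr.
Qed.
Let d_K : ac_deriv K (fun t => (- l^-1 * Th t - C t * th t) * s t).
Proof.
apply: ac_deriv_prim; apply: ig.
exact: (ac_derivB (ac_derivZ _ d_Th) (ac_derivM d_C d_th)).1.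
Qed.

Let H01 : H0 1 = l *: gb.
Proof. by apply/rowP => k; rewrite !mxE mulrCA divff ?mulr1// gt_eqF. Qed.

Let gb_le k : `|gb 0 k| <= l.
Proof.
have : `|H0 1 0 k - H0 0 0 k| <= l * L 1 - l * L 0.
  apply: (ac_deriv_norm_le (d_H0 k) (ac_derivZ l dL)) => // t t01.
  by rewrite mxE normrM (ger0_norm (s0 t)) mulrC ler_wpM2r// curve_coord_le.
rewrite H01 [H0 0 0 k]mxE prim0 L0 !mxE mulr0 !subr0 normrM (gtr0_norm l0) -/l.
by rewrite ler_pM2l.
Qed.

Let Th1 : Th 1 = 0.
Proof.
have d : ac_deriv (fun t => H0 t 0 i - gb 0 i * L t) (fun t => th t * s t).
  apply: ac_deriv_ext (ac_derivB (d_H0 i) (ac_derivZ (gb 0 i) dL)) _ _ => t //.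
  by rewrite mxE /th; ring.
have := ac_deriv_eq d_Th d (lexx 0) ler01 (lexx 1).
rewrite [Th 0]prim0 [H0 0 0 i]mxE prim0 L0 H01 mxE -/l; lra.
Qed.

Let th_le t : 0 <= t <= 1 -> `|th t| <= 2 * l.
Proof.
move=> t01; apply: le_trans (ler_normB _ _) _.
by have := curve_coord_le i t01; have := gb_le i; lra.
Qed.

Let L_mono t : 0 <= t <= 1 -> 0 <= L t <= l.
Proof.
move=> /andP[t0 t1]; rewrite prim_ge0//=.
have := ac_deriv_le (ac_deriv_cst 0) dL (fun x _ => s0 x) t0 t1 (lexx 1).
by rewrite subrr subr_ge0.
Qed.

Let Th_le t : 0 <= t <= 1 -> `|Th t| <= 2 * l * l.
Proof.
move=> t01; have [t0 t1] := andP t01.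
have := ac_deriv_norm_le d_Th (ac_derivZ (2 * l) dL) _ (lexx 0) t0 t1.
rewrite [Th 0]prim0 subr0 L0 mulr0 subr0 => /(_ _)/wrap[] => [x x01|].
  by rewrite normrM (ger0_norm (s0 x)) ler_wpM2r// th_le.
by move=> /le_trans; apply; rewrite ler_wpM2l ?mulr_ge0 ?(ltW l0)//; case/andP: (L_mono t01).
Qed.

Let K1_le : `|K 1| <= 4 * l ^+ 2.
Proof.
have := ac_deriv_norm_le d_K (ac_derivZ (4 * l) dL) _ (lexx 0) ler01 (lexx 1).
rewrite [K 0]prim0 subr0 L0 mulr0 subr0 -/l -mulrA -expr2; apply => t t01.
rewrite normrM (ger0_norm (s0 t)) ler_wpM2r//.
apply: le_trans (ler_normB _ _) _.
have -> : 4 * l = 2 * l + 2 * l by ring.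
apply: lerD.
  rewrite normrM normrN normfV (gtr0_norm l0) mulrC ler_pdivrMr//.
  exact: Th_le.
rewrite normrM -[leRHS]mul1r; apply: ler_pM => //; last exact: th_le.
have /andP[L1 L2] := L_mono t01.
have h1 : 0 <= l^-1 * L t by rewrite mulr_ge0// invr_ge0 ltW.
have h2 : l^-1 * L t <= 1 by rewrite mulrC ler_pdivrMr// mul1r.
by rewrite ger0_norm /C; lra.
Qed.

Let M := H 1.

(** [M 0 i] is a variance: as [Th 1 = 0], [g1] may be centred in it, which gives the integral of
    [th^2] for arc length. The cube of [th] varies by at most three times that integral, and
    [g1 t 0 i] is the difference of [th] at [t] and at [1] because the curve ends at [0]. *)
Let M_ge t : 0 <= t <= 1 -> `|g1 t 0 i| ^+ 3 <= 12 * M 0 i.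
Proof.
move=> /andP[t0 t1].
have d_V := ac_derivB (d_H i) (ac_derivZ (gb 0 i) d_Th).
have d_cube := ac_derivM d_th (ac_derivM d_th d_th).
have := ac_deriv_norm_le d_cube (ac_derivZ 3 d_V) _ t0 t1 (lexx 1).
rewrite Th1 mulr0 subr0 => /(_ _)/wrap[] => [x x01|].
  have -> : u x 0 i * (th x * th x) + th x * (u x 0 i * th x + th x * u x 0 i)
    = 3 * (u x 0 i * th x ^+ 2) by ring.
  rewrite [((s x * th x) *: g1 x) 0 i]mxE normrM (ger0_norm (ler0n _ 3)).
  rewrite ler_wpM2l// normrM.
  rewrite (ger0_norm (sqr_ge0 (th x))).
  have -> : s x * th x * g1 x 0 i - gb 0 i * (th x * s x) = s x * th x ^+ 2.
    by rewrite /th; ring.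
  by rewrite ler_wpM2r ?sqr_ge0.
have V0 : 0 <= H t 0 i - gb 0 i * Th t.
  have /= := ac_deriv_le (ac_deriv_cst 0) d_V _ (lexx 0) t0 t1.
  rewrite subrr [H 0 0 i]mxE prim0 [Th 0]prim0 mulr0 !subr0; apply => x x01.
  have -> : ((s x * th x) *: g1 x) 0 i - gb 0 i * (th x * s x) = s x * th x ^+ 2.
    by rewrite [((s x * th x) *: g1 x) 0 i]mxE /th; ring.
  by rewrite mulr_ge0// sqr_ge0.
(* The constant 12 is the 4 of [cube_diff] times the 3 of the derivative of a cube. *)
have := cube_diff (th t) (th 1).
have -> : th t - th 1 = g1 t 0 i by rewrite /th g11 [in X in _ - X]mxE; ring.
rewrite distrC !exprS !expr0 !mulr1 /M; lra.
Qed.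

(** The first-order decrease of the length per unit of [a 0 k]. *)
Let ck k := prim (fun t => u t 0 k * th t) 1.

Let iuk k : integrable01 (fun t => u t 0 k * th t).
Proof.
apply: (@integrable01_le _ _ (fun t => (2 * l) * s t)).
- have [_ _ mu_ _ _] := Hc; apply: measurable_funM => //.
  apply: subspace_continuous_measurable_fun => //.
  exact: (abs_cont01_continuous d_th.1).
- by move=> t t01; rewrite normrM mulrC ler_pM// th_le.
- exact: integrable01Z.
Qed.

Let ck_le k : `|ck k| <= 2 * l ^+ 2.
Proof.
have := ac_deriv_norm_le (ac_deriv_prim (iuk k)) (ac_derivZ (2 * l) dL) _ (lexx 0) ler01 (lexx 1).
rewrite prim0 subr0 L0 mulr0 subr0 -/l -mulrA -expr2; apply => t t01.
by rewrite normrM mulrC ler_pM// th_le.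
Qed.

(** The displacement of the projected curve: for every [a] it starts at [h], ends at [0] and has
    derivative [- s om]. *)
Let V (h a : 'rV[R]_m) t := C t *: h - Th t *: a.
Let om (h a : 'rV[R]_m) t := l^-1 *: h + th t *: a.

Let d_V h a : vac_deriv (V h a) (fun t => - s t *: om h a t).
Proof.
have := vac_derivD (vac_derivZc h d_C) (vac_derivcZ (-1) (vac_derivZc a d_Th)).
move=> /vac_deriv_ext; apply => t; first by rewrite scaleN1r.
by rewrite /om; apply/rowP => k; rewrite !mxE; ring.
Qed.

(** The constant of integration that brings [G2] to [0] at time 1. It reappears, beside [B h p.1],
    as the vertical displacement of the starting point. *)
Let cst_term (h a : 'rV[R]_m) := 2 *: B gb h + 2 *: B M a - K 1 *: B h a.

(** An explicit primitive of [B (g1 + V) (u - s om)]. Integrating [B V u] by parts produces [B V g1]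
    and doubles the term in [B g1 om], which leaves the moments [H0] and [H] of [g1]. *)
Let G2 h a t := g2 t + B (V h a t) (g1 t)
  - (2 / l) *: B (H0 t) h - 2 *: B (H t) a + K t *: B h a + cst_term h a.

Let d_G2 h a : vac_deriv (G2 h a)
  (fun t => B (g1 t + V h a t) (u t - s t *: om h a t)).
Proof.
have e1 := vac_derivB Bsk (d_V h a) d1.
have e2 := vac_derivcZ (- (2 / l)) (vac_derivB Bsk d_H0 (vac_deriv_cst h)).
have e3 := vac_derivcZ (-2) (vac_derivB Bsk d_H (vac_deriv_cst a)).
have e4 := vac_derivZc (B h a) d_K.
have := vac_derivD (vac_derivD (vac_derivD (vac_derivD (vac_derivD d2 e1) e2) e3) e4)
  (vac_deriv_cst (cst_term h a)).
move=> /vac_deriv_ext; apply => t; first by rewrite /G2 !scaleNr.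
have B00 x : B x 0 = 0 by rewrite (BC Bsk) (B0l Bsk) oppr0.
rewrite !B00 !addr0 /V /om.
rewrite !(BDl Bsk, BDr Bsk, BNl Bsk, BNr Bsk, BZl Bsk, BZr Bsk, Bxx Bsk).
rewrite (BC Bsk h (g1 t)) (BC Bsk a (g1 t)) (BC Bsk a h).
by apply/rowP => k; rewrite !mxE; field; rewrite gt_eqF.
Qed.

Let pcurve h a : curve B
  (p.1 + h, p.2 + (B h p.1 + 2 *: B gb h + B (2 *: M - K 1 *: h) a))
  (fun t => g1 t + V h a t) (G2 h a) (fun t => u t - s t *: om h a t).
Proof.
have [_ _ mu_ _ _] := Hc.
split.
- apply: vac_deriv_ext (vac_derivD d1 (d_V h a)) _ _ => t //.
  by rewrite scaleNr.
- exact: d_G2.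
- move=> k.
  have -> : (fun t => (u t - s t *: om h a t) 0 k) =
     (fun t => u t 0 k - (s t * (l^-1 * h 0 k + th t * a 0 k))).
    by apply/funext => t; rewrite !mxE.
  apply: measurable_funB => //; apply: measurable_funM.
    exact: measurable_enorm.
  apply: measurable_funD => //; apply: measurable_funM => //.
  apply: subspace_continuous_measurable_fun => //.
  exact: (abs_cont01_continuous d_th.1).
- have V0 : V h a 0 = h by rewrite /V /C L0 mulr0 subr0 scale1r [Th 0]prim0 scale0r subr0.
  have H00 : H0 0 = 0 by apply/rowP => k; rewrite !mxE prim0.
  have H0' : H 0 = 0 by apply/rowP => k; rewrite !mxE prim0.
  rewrite /G2 V0 H00 H0' !(B0l Bsk) [K 0]prim0 g10 g20; congr pair.
  rewrite /cst_term (BDl Bsk) (BNl Bsk) !(BZl Bsk).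
  by apply/rowP => k; rewrite !mxE; ring.
- have V1 : V h a 1 = 0.
    by rewrite /V /C -/l mulVf ?gt_eqF// subrr Th1 !scale0r subrr.
  rewrite /G2 V1 g11 g21 (B0l Bsk) addr0; split=> //.
  rewrite H01 (BZl Bsk) -/M /cst_term.
  by apply/rowP => k; rewrite !mxE; field; rewrite gt_eqF.
Qed.

(** The term in [h] and [p.1] arises because the control integrates to [- p.1]. It is odd in [h],
    which later produces the cancellation between [h] and [- h]. *)
Lemma perturbation : exists (M gb c : 'rV[R]_m) (kap : R),
  [/\ `|gb| <= l, `|c| <= 2 * l ^+ 2, `|kap| <= 4 * l ^+ 2,
      (forall t, 0 <= t <= 1 -> `|g1 t 0 i| ^+ 3 <= 12 * M 0 i) &
      forall h a, (cc_dist B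
        (p.1 + h, p.2 + (B h p.1 + 2 *: B gb h + B (2 *: M - kap *: h) a))%R 0%R
      <= (l + (\sum_k h 0 k * p.1 0 k) / l - \sum_k a 0 k * c 0 k
          + m%:R / 2 * l * (`|h| / l + 2 * l * `|a|) ^+ 2)%:E)%E].
Proof.
exists M, gb, (\row_k ck k), (K 1); split=> //.
- by apply: mx_norm_le => [|a b]; [exact: ltW|rewrite ord1; exact: gb_le].
- apply: mx_norm_le => [|a b]; first by rewrite mulr_ge0// sqr_ge0.
  by rewrite mxE; exact: ck_le.
move=> h a; set W := `|h| / l + 2 * l * `|a|.
have W0 : 0 <= W by rewrite addr_ge0// ?mulr_ge0// ?invr_ge0 ltW.
(* The bound of [enorm_shift], with each coordinate of [om] in the quadratic term replaced by its
   bound [W]. *)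
pose psi t := s t - (\sum_k (l^-1 * h 0 k * u t 0 k + a 0 k * (u t 0 k * th t)))
  + (m%:R / 2 * W ^+ 2) * s t.
have iuk' k : integrable01 (fun t => u t 0 k).
  apply: (@integrable01_le _ _ s) => //; by have [_ _ + _ _] := Hc.
have ipsi : integrable01 psi.
  apply: integrable01D; last exact: integrable01Z.
  apply: integrable01D => //; rewrite -[X in integrable01 X]/(fun t => _).
  have : integrable01 (fun t => -1 * \sum_k (l^-1 * h 0 k * u t 0 k + a 0 k * (u t 0 k * th t))).
    apply: integrable01Z; apply: integrable01_sum => k; apply: integrable01D.
      exact: integrable01Z.
    exact: integrable01Z.
  by congr (integrable01 _); apply/funext => t; rewrite mulN1r.
have psi_le t : 0 <= t <= 1 -> enorm (u t - s t *: om h a t) <= psi t.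
  move=> t01; apply: le_trans (enorm_shift _ _) _; rewrite -/(s t) /psi.
  apply: lerD.
    rewrite lerD2l lerN2 le_eqVlt; apply/orP; left; apply/eqP.
    by apply: eq_bigr => k _; rewrite !mxE; ring.
  have : \sum_k om h a t 0 k ^+ 2 <= m%:R * W ^+ 2.
    apply: (@le_trans _ _ (\sum_(k < m) W ^+ 2)).
      apply: ler_sum => k _; rewrite -real_normK ?num_real// ler_sqr ?nnegrE//.
      rewrite !mxE; apply: le_trans (ler_normD _ _) _; rewrite !normrM normfV (gtr0_norm l0).
      apply: lerD; first by rewrite mulrC ler_wpM2r ?invr_ge0 ?(ltW l0)// mx_coord_le.
      by apply: ler_pM => //; [exact: th_le|exact: mx_coord_le].
    by rewrite sumr_const card_ord mulr_natl.
  move=> hW; have := s0 t; nra.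
apply: le_trans (cc_dist_le (pcurve h a) ipsi psi_le) _.
rewrite lee_fin le_eqVlt; apply/orP; left; apply/eqP.
(* The integral of [psi] is read off an explicit primitive. *)
have dpsi : ac_deriv (fun t => L t - (\sum_k (l^-1 * h 0 k * g1 t 0 k
    + a 0 k * prim (fun t => u t 0 k * th t) t)) + (m%:R / 2 * W ^+ 2) * L t) psi.
  apply: ac_derivD; last exact: ac_derivZ.
  apply: ac_derivB => //; apply: ac_deriv_sum => k _; apply: ac_derivD.
    exact: (ac_derivZ _ (d1 k)).
  by apply: ac_derivZ; exact: ac_deriv_prim.
have := ac_deriv_eq (ac_deriv_prim ipsi) dpsi (lexx 0) ler01 (lexx 1).
rewrite prim0 subr0 => ->; rewrite L0 -/l g11 g10.
have -> : \sum_k (l^-1 * h 0 k * (0 : 'rV[R]_m) 0 k + a 0 k * prim (fun t => u t 0 k * th t) 1)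
  = \sum_k a 0 k * (\row_j ck j) 0 k.
  by apply: eq_bigr => k _; rewrite !mxE mulr0 add0r.
have -> : \sum_k (l^-1 * h 0 k * p.1 0 k + a 0 k * prim (fun t => u t 0 k * th t) 0)
  = (\sum_k h 0 k * p.1 0 k) / l.
  by rewrite mulr_suml; apply: eq_bigr => k _; rewrite prim0 mulr0 addr0; ring.
ring.
Qed.

End Perturbation.

(** * Ball-box estimates and finiteness of the distance *)

Section BallBox.
Variables (R : realType) (m n2 : nat).
Variable B : 'rV[R]_m -> 'rV[R]_m -> 'rV[R]_n2.
Hypothesis HB : ideal_carnot B.
Let Bsk : skew_bilinear B. Proof. by have [] := HB. Qed.

Lemma enorm_le_norm k (x : 'rV[R]_k) : enorm x <= k%:R * `|x|.
Proof.
rewrite -ler_sqr ?nnegrE ?enorm_ge0 ?mulr_ge0// enorm_sqr.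
apply: (@le_trans _ _ (\sum_(i < k) `|x| ^+ 2)).
  apply: ler_sum => i _; rewrite -real_normK ?num_real// ler_sqr ?nnegrE//.
  exact: mx_coord_le.
rewrite sumr_const card_ord -[leLHS]mulr_natl exprMn ler_wpM2r ?sqr_ge0//.
by rewrite -natrX ler_nat -{1}[k]expn1; case: (k) => // k'; rewrite leq_pexp2l.
Qed.

Lemma integrable01_cst (c : R) : integrable01 (fun=> c).
Proof.
apply: continuous_compact_integrable; first exact: segment_compact.
exact/continuous_subspaceT/cst_continuous.
Qed.

(** One application per coefficient differentiates a polynomial in Horner form. *)
Lemma ac_deriv_horner_step (c : R) (f phi : R -> R) : ac_deriv f phi ->
  ac_deriv (fun t => c + t * f t) (fun t => f t + t * phi t).
Proof.
move=> h; have := ac_derivD (ac_deriv_cst c) (ac_derivM (ac_deriv_id R) h).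
by move=> /ac_deriv_ext; apply => t //; rewrite add0r mul1r.
Qed.

(** Otherwise all brackets would vanish, against step 2. *)
Lemma step2_nonzero (z : 'rV[R]_n2) : z != 0 -> exists e : 'rV[R]_m, e != 0.
Proof.
move=> z0; apply: contrapT => H.
have all0 (e : 'rV[R]_m) : e = 0.
  by apply: contrapT => /eqP e0; apply: H; exists e.
have [_ [[_ /(_ (0, z) erefl)[k [Y [W [_ [_ /(congr1 snd)/= E]]]]]] _]] := HB.
move/eqP : z0; apply; rewrite E (big_morph snd (id1 := 0) (op1 := +%R))//.
by rewrite big1// => i _ /=; rewrite (all0 (Y i).1) (B0l Bsk) scaler0.
Qed.

(** Both factors are of the order of the square root of the size of [z], the length of a loop
    sweeping the area [z]. [x] is any nonzero vector rescaled, and [fat_bound] provides [y]. *)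
Lemma loop_vectors : exists2 K : R, 0 <= K & forall z : 'rV[R]_n2,
  exists x y : 'rV[R]_m, [/\ B x y = z, `|x| <= Num.sqrt `|z| &
    `|y| <= K * Num.sqrt `|z|].
Proof.
have [_ [_ Bfat]] := HB.
have [K K0 HK] := fat_bound Bsk Bfat.
exists K => // z; have [->|z0] := eqVneq z 0.
  by exists 0, 0; rewrite (B0l Bsk) !normr0 sqrtr0 mulr0.
have [e e0] := step2_nonzero z0.
have sz : 0 < Num.sqrt `|z| by rewrite sqrtr_gt0 normr_gt0.
have ne : 0 < `|e| by rewrite normr_gt0.
pose x := (Num.sqrt `|z| / `|e|) *: e.
have nx : `|x| = Num.sqrt `|z|.
  by rewrite /x normrZ normrM normfV normr_id (gtr0_norm sz) mulfVK// gt_eqF.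
have [|y Bxy] := HK x z; first by rewrite -normr_eq0 nx gt_eqF.
rewrite nx => ny; exists x, y; split=> //; first by rewrite nx.
by rewrite -(ler_pM2l sz) mulrCA -expr2 sqr_sqrtr.
Qed.

(* The loops [phi] and [psi] have zero mean, so that they do not interact with
   the segment from [p.1] to [0]; together they sweep the area [-1/35]. *)
Lemma ball_box : exists2 K : R, 0 <= K & forall p : carnot_pt R m n2,
  (cc_dist B p 0%R <= (K * (`|p.1| + Num.sqrt `|p.2|))%:E)%E.
Proof.
have [K K0 HK] := loop_vectors.
pose phi (t : R) := t - 3 * t ^+ 2 + 2 * t ^+ 3.
pose phi' (t : R) := 1 - 6 * t + 6 * t ^+ 2.
pose psi (t : R) := t - 6 * t ^+ 2 + 10 * t ^+ 3 - 5 * t ^+ 4.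
pose psi' (t : R) := 1 - 12 * t + 30 * t ^+ 2 - 20 * t ^+ 3.
(* [P1], [P2] and [P3] are the coefficients of [B p.1 x], [B p.1 y] and [B x y] in the vertical
   coordinate. The zero means give [P1 1 = P2 1 = 0]. *)
pose P1 (t : R) := t - 3 * t ^+ 2 + 3 * t ^+ 3 - t ^+ 4.
pose P2 (t : R) := t - 6 * t ^+ 2 + 12 * t ^+ 3 - 10 * t ^+ 4 + 3 * t ^+ 5.
pose P3 (t : R) := - t ^+ 3 + 4 * t ^+ 4 - 33 / 5 * t ^+ 5 + 5 * t ^+ 6 - 10 / 7 * t ^+ 7.
have st := ac_deriv_horner_step; have c0 := @ac_deriv_cst R.
have dphi : ac_deriv phi phi'.
  apply: ac_deriv_ext (st 0 _ _ (st 1 _ _ (st (-3) _ _ (c0 2)))) _ _ => t.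
  - by rewrite /phi; ring.
  - by rewrite /phi'; ring.
have dpsi : ac_deriv psi psi'.
  apply: ac_deriv_ext (st 0 _ _ (st 1 _ _ (st (-6) _ _ (st 10 _ _ (c0 (-5)))))) _ _ => t.
  - by rewrite /psi; ring.
  - by rewrite /psi'; ring.
have da : ac_deriv (fun t : R => 1 - t) (fun=> -1).
  apply: ac_deriv_ext (st 1 _ _ (c0 (-1))) _ _ => t; ring.
have dP1 : ac_deriv P1 (fun t => (1 - t) * phi' t + phi t).
  apply: ac_deriv_ext (st 0 _ _ (st 1 _ _ (st (-3) _ _ (st 3 _ _ (c0 (-1)))))) _ _ => t.
  - by rewrite /P1; ring.
  - by rewrite /phi /phi'; ring.
have dP2 : ac_deriv P2 (fun t => (1 - t) * psi' t + psi t).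
  apply: ac_deriv_ext (st 0 _ _ (st 1 _ _ (st (-6) _ _ (st 12 _ _ (st (-10) _ _
    (c0 3)))))) _ _ => t.
  - by rewrite /P2; ring.
  - by rewrite /psi /psi'; ring.
have dP3 : ac_deriv P3 (fun t => phi t * psi' t - psi t * phi' t).
  apply: ac_deriv_ext (st 0 _ _ (st 0 _ _ (st 0 _ _ (st (-1) _ _ (st 4 _ _
    (st (- (33 / 5)) _ _ (st 5 _ _ (c0 (- (10 / 7)))))))))) _ _ => t.
  - by rewrite /P3; ring.
  - by rewrite /psi /psi' /phi /phi'; field.
(* 13 and 63 are the sums of the absolute values of the coefficients of [phi'] and [psi'], hence
   bounds on [[0, 1]]. *)
pose D := 13 + 63 * K.
have D0 : 0 <= D by rewrite addr_ge0// mulr_ge0.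
pose D35 := D * Num.sqrt 35.
have D350 : 0 <= D35 by rewrite mulr_ge0// sqrtr_ge0.
exists (m%:R * (1 + D35)) => [|p]; first by rewrite mulr_ge0// addr_ge0.
(* The factor 35 compensates [P3 1 = - 1 / 35], so that the loops bring [p.2] to [0]. *)
have [x [y [Bxy nx ny]]] := HK (35 *: p.2).
have n35 : Num.sqrt `|35 *: p.2| = Num.sqrt 35 * Num.sqrt `|p.2|.
  by rewrite normrZ (ger0_norm (ler0n _ 35)) sqrtrM.
pose g1 (t : R) := (1 - t) *: p.1 + phi t *: x + psi t *: y.
pose u (t : R) := -1 *: p.1 + phi' t *: x + psi' t *: y.
pose g2 (t : R) := p.2 + P1 t *: B p.1 x + P2 t *: B p.1 y + P3 t *: B x y.
have cg : curve B p g1 g2 u.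
  split.
  - exact: vac_derivD (vac_derivD (vac_derivZc _ da) (vac_derivZc _ dphi)) (vac_derivZc _ dpsi).
  - apply: vac_deriv_ext (vac_derivD (vac_derivD (vac_derivD (vac_deriv_cst p.2)
      (vac_derivZc _ dP1)) (vac_derivZc _ dP2)) (vac_derivZc _ dP3)) _ _ => t //.
    rewrite /g1 /u !(BDl Bsk, BDr Bsk, BZl Bsk, BZr Bsk, Bxx Bsk).
    rewrite (BC Bsk x p.1) (BC Bsk y p.1) (BC Bsk y x).
    by apply/rowP => k; rewrite !mxE; ring.
  - move=> i; apply: subspace_continuous_measurable_fun => //.
    have -> : (fun t => u t 0 i) = fun t => (- p.1 0 i) + phi' t * x 0 i + psi' t * y 0 i.
      by apply/funext => t; rewrite !mxE; ring.
    apply: abs_cont01_continuous.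
    have dphi'' := st 1 _ _ (st (-6) _ _ (c0 6)).
    have dpsi'' := st 1 _ _ (st (-12) _ _ (st 30 _ _ (c0 (-20)))).
    have := ac_derivD (ac_derivD (c0 (- p.1 0 i)) (ac_derivM dphi'' (c0 (x 0 i))))
      (ac_derivM dpsi'' (c0 (y 0 i))).
    move=> [+ _]; congr (abs_cont01 _); apply/funext => t.
    by rewrite /phi' /psi'; ring.
  - rewrite /g1 /g2 /phi /psi /P1 /P2 /P3 [RHS]surjective_pairing; congr pair.
      by apply/rowP => k; rewrite !mxE; ring.
    by apply/rowP => k; rewrite !mxE; ring.
  - rewrite /g1 /g2 Bxy /phi /psi /P1 /P2 /P3; split.
      by apply/rowP => k; rewrite !mxE; ring.
    by apply/rowP => k; rewrite !mxE; field.
set bnd := m%:R * (1 + D35) * (`|p.1| + Num.sqrt `|p.2|).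
apply: le_trans (cc_dist_le cg (integrable01_cst bnd) _) _.
  move=> t /andP[t0 t1]; apply: le_trans (enorm_le_norm _) _.
  rewrite /bnd -mulrA ler_wpM2l//.
  have h1 : `|phi' t| <= 13 by rewrite ler_norml /phi'; apply/andP; split; nra.
  have t2 : 0 <= t ^+ 2 <= 1 by rewrite sqr_ge0/= expr_le1.
  have t3 : 0 <= t ^+ 3 <= 1 by rewrite exprn_ge0//= expr_le1.
  have h2 : `|psi' t| <= 63 by rewrite ler_norml /psi'; apply/andP; split; lra.
  apply: (@le_trans _ _ (`|p.1| + 13 * `|x| + 63 * `|y|)).
    rewrite /u; apply: le_trans (ler_normD _ _) _; apply: lerD.
      apply: le_trans (ler_normD _ _) _; apply: lerD; first by rewrite scaleN1r normrN.
      by rewrite normrZ ler_wpM2r.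
    by rewrite normrZ ler_wpM2r.
  have := sqrtr_ge0 `|p.2|; have := normr_ge0 p.1; move: nx ny.
  rewrite n35 /D35 /D; set sp := Num.sqrt `|p.2|; set s35 := Num.sqrt 35.
  have : 0 <= s35 := sqrtr_ge0 _.
  move=> s0 nx ny n1 sp0.
  have a1 : 0 <= (13 + 63 * K) * s35 * `|p.1| by rewrite !mulr_ge0.
  have -> : (1 + (13 + 63 * K) * s35) * (`|p.1| + sp) = `|p.1| + sp +
     (13 + 63 * K) * s35 * `|p.1| + 13 * (s35 * sp) + 63 * (K * (s35 * sp)) by ring.
  lra.
rewrite lee_fin.
have dc : ac_deriv (fun t => bnd * t) (fun=> bnd).
  by apply: ac_deriv_ext (ac_derivZ bnd (ac_deriv_id R)) _ _ => t //; rewrite mulr1.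
have := ac_deriv_eq (ac_deriv_prim (integrable01_cst bnd)) dc (lexx 0) ler01 (lexx 1).
by rewrite prim0 subr0 mulr0 subr0 mulr1 => ->.
Qed.

Lemma cc_dist_fin p : cc_dist B p 0 \is a fin_num.
Proof.
have [K _ H] := ball_box.
by rewrite ge0_fin_numE ?cc_dist_ge0// (le_lt_trans (H p))// ltry.
Qed.

Let N (p : carnot_pt R m n2) := fine (cc_dist B p 0).

Lemma near_optimal_curve p e : N p < e -> exists g1 g2 u,
  [/\ curve B p g1 g2 u, integrable01 (fun t => enorm (u t)),
      N p <= prim (fun t => enorm (u t)) 1 &
      prim (fun t => enorm (u t)) 1 < e].
Proof.
rewrite /N -lte_fin fineK ?cc_dist_fin// => /ereal_inf_lt[x px xe].
have [|g1 [g2 [u [cu iu E]]]] := cc_lengths_curve px.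
  by rewrite (lt_le_trans xe)// leey.
exists g1, g2, u; split=> //; rewrite -?lee_fin -?lte_fin -E//.
by rewrite fineK ?cc_dist_fin//; exact: ereal_inf_lbound.
Qed.

(** The converse of [ball_box]: the projection of a curve of length [l] stays within [l] of [0], so
    the area it sweeps is of order [l^2]. *)
Lemma cc_box p e : N p < e -> `|p.1| <= e /\ `|p.2| <= Bbound B * e ^+ 2.
Proof.
move=> /near_optimal_curve[g1 [g2 [u [cu iu lN le]]]].
have l0 : 0 <= prim (fun t => enorm (u t)) 1 by apply: prim_ge0 => x _; exact: enorm_ge0.
have e0 : 0 <= e by lra.
have H := curve_coord_le cu iu.
have [_ _ _ <- _] := cu; split=> /=.
  apply: mx_norm_le => // i j; rewrite ord1; apply: le_trans (H _ _ _) (ltW le).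
  by rewrite lexx ler01.
apply: mx_norm_le => [|i j]; first by rewrite mulr_ge0 ?Bbound_ge0 ?sqr_ge0.
have := curve_end2_le Bsk cu iu j l0 H.
have [_ _ _ <- _] := cu; rewrite ord1 /= => /le_trans; apply.
by rewrite ler_wpM2l ?Bbound_ge0// expr2 ler_pM// ltW.
Qed.

End BallBox.

(** * Lower semicontinuity and semiconcavity of the squared distance *)

Section Semiconcavity.
Variables (R : realType) (m n2 : nat).
Variable B : 'rV[R]_m -> 'rV[R]_m -> 'rV[R]_n2.
Hypothesis HB : ideal_carnot B.
Let Bsk : skew_bilinear B. Proof. by have [] := HB. Qed.
Let N (p : carnot_pt R m n2) := fine (cc_dist B p 0).
Let b := Bbound B.
Let b0 : 0 <= b. Proof. exact: Bbound_ge0. Qed.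

Let N0 p : 0 <= N p.
Proof. by apply: fine_ge0; exact: cc_dist_ge0. Qed.

Lemma fine_cc_dist_le p (x : R) : (cc_dist B p 0%R <= x%:E)%E -> N p <= x.
Proof. by rewrite -lee_fin /N fineK// cc_dist_fin. Qed.

Lemma fine_ball_box : exists2 K : R, 0 <= K & forall p, N p <= K * (`|p.1| + Num.sqrt `|p.2|).
Proof.
by have [K K0 H] := ball_box HB; exists K => // p; exact: fine_cc_dist_le.
Qed.

Lemma sum_mul_le (x y : 'rV[R]_m) : `|\sum_k x 0 k * y 0 k| <= m%:R * (`|x| * `|y|).
Proof.
apply: le_trans (ler_norm_sum _ _ _) _.
apply: (@le_trans _ _ (\sum_(k < m) (`|x| * `|y|))).
  by apply: ler_sum => k _; rewrite normrM ler_pM// mx_coord_le.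
by rewrite sumr_const card_ord mulr_natl.
Qed.

Lemma curve_start_le p g1 g2 u : curve B p g1 g2 u ->
  integrable01 (fun t => enorm (u t)) -> `|p.1| <= prim (fun t => enorm (u t)) 1.
Proof.
move=> cu iu; have H := curve_coord_le cu iu; have [_ _ _ <- _] := cu.
apply: mx_norm_le => [|i j]; first by apply: prim_ge0 => x _; exact: enorm_ge0.
by rewrite ord1; apply: H; rewrite lexx ler01.
Qed.

(** Otherwise [p.1] is of order [e^2 l] and, by [curve_end2_le], [p.2] of order [(e l)^2], so the
    upper ball-box bound makes [N p] smaller than [l / 2]. *)
Lemma long_excursion : exists2 d : R, 0 < d & forall p g1 g2 u,
  curve B p g1 g2 u -> integrable01 (fun t => enorm (u t)) ->
  let l := prim (fun t => enorm (u t)) 1 in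
  0 < l -> l <= 2 * N p -> exists i t, 0 <= t <= 1 /\ d * l < `|g1 t 0 i|.
Proof.
have [K K0 HK] := fine_ball_box.
have sb : 0 <= Num.sqrt b by exact: sqrtr_ge0.
(* Chosen so that, for [e = D^-1], the ball-box bound is at most [l / 4]. *)
pose D := 4 * ((K + 1) * (1 + Num.sqrt b)).
have D4 : 4 <= D.
  have : 0 <= K * Num.sqrt b by rewrite mulr_ge0.
  by rewrite /D; lra.
pose e := D^-1.
have e0 : 0 < e by rewrite invr_gt0; lra.
have e1 : e <= 1 by rewrite invf_le1; lra.
exists (e ^+ 2) => [|p g1 g2 u cu iu l l0 lN]; first by rewrite exprn_gt0.
apply: contrapT => H.
have Hg k t : 0 <= t <= 1 -> `|g1 t 0 k| <= e ^+ 2 * l.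
  by move=> t01; rewrite leNgt; apply/negP => kt; apply: H; exists k, t.
have el : 0 <= e ^+ 2 * l by rewrite mulr_ge0 ?sqr_ge0// ltW.
have p1 : `|p.1| <= e ^+ 2 * l.
  have [_ _ _ <- _] := cu; apply: mx_norm_le => // i j; rewrite ord1 /=.
  by apply: Hg; rewrite lexx ler01.
have p2 : `|p.2| <= b * (e * l) ^+ 2.
  apply: mx_norm_le => [|i j]; first by rewrite mulr_ge0 ?sqr_ge0.
  rewrite ord1; apply: le_trans (curve_end2_le Bsk cu iu j el Hg) _.
  by rewrite -/b -/l exprMn -mulrA expr2 -mulrA.
have s2 : Num.sqrt `|p.2| <= Num.sqrt b * (e * l).
  apply: le_trans (ler_wsqrtr p2) _; rewrite sqrtrM// sqrtr_sqr ger0_norm//.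
  by rewrite mulr_ge0// ltW.
have := HK p.
have : K * (`|p.1| + Num.sqrt `|p.2|) <= K * (e ^+ 2 * l + Num.sqrt b * (e * l)).
  by rewrite ler_wpM2l// lerD.
have : e ^+ 2 * l <= e * l by rewrite ler_wpM2r ?(ltW l0)// expr2 ler_piMl// ltW.
have E : (K + 1) * (1 + Num.sqrt b) * (e * l) = l / 4.
  rewrite mulrA; have -> : (K + 1) * (1 + Num.sqrt b) = D / 4 by rewrite /D; field.
  by rewrite /e; field; lra.
have : 0 <= (1 + Num.sqrt b) * (e * l) by rewrite !mulr_ge0 ?addr_ge0// ltW.
move=> n1 n2' n3 n4.
have n5 : K * (e ^+ 2 * l) <= K * (e * l) by rewrite ler_wpM2l.
move: E; rewrite mulrDl mulrDr mulrDl; lra.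
Qed.

(* The first variation of the end point of a near-optimal curve, in the
   vertical directions, is bounded below: this is where fatness is used. *)
Lemma solvable_perturbation : exists c K : R, [/\ 0 < c, 0 <= K & forall p g1 g2 u,
  curve B p g1 g2 u -> integrable01 (fun t => enorm (u t)) ->
  let l := prim (fun t => enorm (u t)) 1 in
  0 < l -> l <= 2 * N p -> exists (M gb v : 'rV[R]_m) (kap : R),
  [/\ `|gb| <= l, `|v| <= 2 * l ^+ 2, `|kap| <= 4 * l ^+ 2,
      (forall h z, `|h| <= c * l -> exists2 a, B (2 *: M - kap *: h) a = z &
         l ^+ 3 * `|a| <= K * `|z|) &
      forall h a, N (p.1 + h, p.2 + (B h p.1 + 2 *: B gb h + B (2 *: M - kap *: h) a))
      <= l + (\sum_k h 0 k * p.1 0 k) / l - \sum_k a 0 k * v 0 k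
          + m%:R / 2 * l * (`|h| / l + 2 * l * `|a|) ^+ 2]].
Proof.
have [d d0 Hd] := long_excursion.
have [_ [_ Bfat]] := HB; have [K K0 HK] := fat_bound Bsk Bfat.
(* The excursion [d l], cubed and divided by 12, bounds [M] from below. *)
pose c1 := d ^+ 3 / 12.
have c10 : 0 < c1 by rewrite divr_gt0// exprn_gt0.
exists (c1 / 4), (K / c1); split; [by rewrite divr_gt0|by rewrite divr_ge0// ltW|].
move=> p g1 g2 u cu iu l l0 lN.
have [i [t [t01 it]]] := Hd _ _ _ _ cu iu l0 lN.
have [M [gb [v [kap [Hgb Hv Hkap HM Hcc]]]]] := perturbation Bsk cu iu l0 i.
exists M, gb, v, kap; split=> //; last first.
  by move=> h a; apply: fine_cc_dist_le; exact: Hcc.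
have l3 : 0 < l ^+ 3 by rewrite exprn_gt0.
have Mge : c1 * l ^+ 3 <= `|M|.
  apply: (@le_trans _ _ (M 0 i)); last exact: le_trans (ler_norm _) (mx_coord_le _ _ _).
  have : (d * l) ^+ 3 <= `|g1 t 0 i| ^+ 3.
    by rewrite lerXn2r ?nnegrE// ?mulr_ge0 ?ltW.
  by have := HM _ t01; rewrite exprMn /c1; lra.
move=> h z hc.
(* With [|h| <= c1 / 4 * l], the term [kap *: h] has size at most [c1 * l ^+ 3], which is half of
   the lower bound for [2 *: M]. *)
have Xge : c1 * l ^+ 3 <= `|2 *: M - kap *: h|.
  apply: le_trans (lerB_dist _ _); rewrite !normrZ (ger0_norm (ler0n _ 2)).
  have : `|kap| * `|h| <= 4 * l ^+ 2 * (c1 / 4 * l) by rewrite ler_pM.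
  have -> : 4 * l ^+ 2 * (c1 / 4 * l) = c1 * l ^+ 3 by field.
  lra.
have X0 : 0 < `|2 *: M - kap *: h| by apply: lt_le_trans Xge; rewrite mulr_gt0.
have [|a Ba na] := HK (2 *: M - kap *: h) z; first by rewrite -normr_gt0.
exists a => //; rewrite [leRHS]mulrAC ler_pdivlMr// [leLHS]mulrC [leLHS]mulrA.
by apply: le_trans na; rewrite ler_wpM2r.
Qed.

(** A near-optimal curve of the nearby point [q] is bent so as to start at [p], which bounds [N p]
    by [N q] plus a small error. *)
Lemma cc_dist_lsc : lsc_on setT (fun p => N p ^+ 2).
Proof.
move=> p _ eps eps0.
have [Np0|Npn0] := eqVneq (N p) 0.
  exists 1 => // q _ _; rewrite Np0 expr0n /= sub0r.
  by apply: lt_le_trans (sqr_ge0 _); rewrite oppr_lt0.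
have Np : 0 < N p by rewrite lt_def Npn0 N0.
have [K K0 HK] := fine_ball_box.
have [c [K' [c0 K'0 Hs]]] := solvable_perturbation.
pose S := Num.sqrt (b + 1).
have S0 : 0 <= S := sqrtr_ge0 _.
(* If [N q] were below [nu], then [p] would lie in a box so small that the ball-box bound gives at
   most [N p / 2]. *)
pose nu := N p / (2 * ((K + 1) * (2 + S))).
have den : 0 < 2 * ((K + 1) * (2 + S)) by rewrite !mulr_gt0//; lra.
have nu0 : 0 < nu by rewrite divr_gt0.
(* A margin for [N] itself: [(N p - e) ^+ 2] is still above [N p ^+ 2 - eps]. *)
pose e := Num.min (eps / (2 * N p)) (N p).
have e0 : 0 < e by rewrite lt_min Np andbT divr_gt0// mulr_gt0.
have eN : e <= N p by rewrite ge_min lexx orbT.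
have eeps : 2 * N p * e <= eps.
  by rewrite mulrC -ler_pdivlMr ?mulr_gt0// ge_min lexx.
clearbody e.
(* all lengths involved lie in [[nu, N p]] *)
pose T := K' * (1 + 3 * b * N p) / nu ^+ 3.
have nu0' := ltW nu0; have Np' := ltW Np.
have T0 : 0 <= T by rewrite divr_ge0 ?exprn_ge0// mulr_ge0// addr_ge0// !mulr_ge0.
(* [E * dl] collects the bounds [t1], [t2] and [t3] of the three error terms of the perturbed
   length. *)
pose E := m%:R + T * (m%:R * (2 * N p ^+ 2)) + m%:R / 2 * N p * (nu^-1 + 2 * N p * T) ^+ 2.
have E0 : 0 <= E.
  apply: addr_ge0; last by rewrite mulr_ge0 ?sqr_ge0// mulr_ge0// divr_ge0.
  by rewrite addr_ge0// mulr_ge0// mulr_ge0// mulr_ge0// sqr_ge0.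
have E1 : 0 < E + 1 by lra.
pose dl := Num.min (Num.min 1 (e / (2 * (E + 1)))) (Num.min (Num.min nu (nu ^+ 2)) (c * nu)).
have dl0 : 0 < dl.
  by rewrite !lt_min ltr01 nu0 exprn_gt0// (mulr_gt0 c0 nu0) !andbT/= divr_gt0// mulr_gt0.
have [dl1 dlE dlnu dlnu2 dlc] : [/\ dl <= 1, 2 * (E + 1) * dl <= e, dl <= nu,
    dl <= nu ^+ 2 & dl <= c * nu].
  have : dl <= dl by [].
  rewrite {2}/dl !le_min => /andP[/andP[d1 d2] /andP[/andP[d3 d4] d5]]; split=> //.
  by move: d2; rewrite ler_pdivlMr ?mulr_gt0// mulrC.
exists dl; [exact: dl0|move=> q _ qp].
have coord_pnorm (z : carnot_pt R m n2) : `|z.1| <= pnorm z /\ `|z.2| <= pnorm z.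
  have s1 : 0 <= \sum_i z.1 0 i ^+ 2 by apply: sumr_ge0 => i _; exact: sqr_ge0.
  have s2 : 0 <= \sum_i z.2 0 i ^+ 2 by apply: sumr_ge0 => i _; exact: sqr_ge0.
  split.
    by apply: le_trans (norm_le_enorm _) _; rewrite ler_wsqrtr// lerDl.
  by apply: le_trans (norm_le_enorm _) _; rewrite ler_wsqrtr// lerDr.
have [h1 h2] : `|p.1 - q.1| <= dl /\ `|p.2 - q.2| <= dl.
  have [h1 h2] := coord_pnorm (q.1 - p.1, q.2 - p.2).
  rewrite distrC [X in _ /\ X <= _]distrC.
  by split; [exact: le_trans h1 (ltW qp)|exact: le_trans h2 (ltW qp)].
suff : N p - e < N q.
  move=> pq; have [qlt|] := ltP (N q) (N p); last first.
    by move=> h; apply: (@lt_le_trans _ _ (N p ^+ 2)); rewrite ?gtrBl// ler_sqr ?nnegrE ?N0.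
  have := N0 q; clear - HB Bsk b0 N0 pq qlt e0 eN eeps Np; nra.
(* The contrary assumption also yields [l <= N p], hence bounds that do not depend on [q]. *)
have [//|qsmall] := ltP (N p - e) (N q).
have nuq : nu <= N q.
  rewrite leNgt; apply/negP => qnu.
  have [q1 q2] := cc_box HB qnu.
  have p1 : `|p.1| <= 2 * nu.
    have -> : p.1 = (p.1 - q.1) + q.1 by rewrite subrK.
    apply: le_trans (ler_normD _ _) _; clear - HB Bsk b0 N0 h1 q1 dlnu; lra.
  have p2 : `|p.2| <= (b + 1) * nu ^+ 2.
    have -> : p.2 = (p.2 - q.2) + q.2 by rewrite subrK.
    apply: le_trans (ler_normD _ _) _; rewrite -/b in q2; clear - HB Bsk b0 N0 h2 q2 dlnu2; lra.
  have s2 : Num.sqrt `|p.2| <= S * nu.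
    by apply: le_trans (ler_wsqrtr p2) _; rewrite sqrtrM ?addr_ge0// sqrtr_sqr gtr0_norm.
  have := HK p.
  have : K * (`|p.1| + Num.sqrt `|p.2|) <= (K + 1) * (2 * nu + S * nu).
    apply: ler_pM => //; first by rewrite lerDl.
    exact: lerD.
  have -> : (K + 1) * (2 * nu + S * nu) = N p / 2.
    by rewrite /nu; field; clear - HB Bsk b0 N0 K0 S0; rewrite !gt_eqF//; lra.
  by clear - HB Bsk b0 N0 Np; lra.
have e2 : N q < N q + Num.min (e / 2) (N q) by rewrite ltrDl lt_min divr_gt0// (lt_le_trans nu0).
have [g1 [g2 [u [cu iu Nl lN]]]] := near_optimal_curve HB e2.
have [l1 l2] : prim (fun t => enorm (u t)) 1 < N q + e / 2 /\
    prim (fun t => enorm (u t)) 1 <= 2 * N q.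
  have m1 : Num.min (e / 2) (N q) <= e / 2 by rewrite ge_min lexx.
  have m2 : Num.min (e / 2) (N q) <= N q by rewrite ge_min lexx orbT.
  by split; clear - HB Bsk b0 N0 lN m1 m2; lra.
set l := prim _ _ in Nl lN l1 l2.
have nul : nu <= l by apply: le_trans Nl.
have l0 : 0 < l := lt_le_trans nu0 nul.
have lp : l <= N p by clear - HB Bsk b0 N0 l1 qsmall e0; lra.
have [M [gb [v [kap [Hgb Hv Hkap Hsol Hcc]]]]] := Hs _ _ _ _ cu iu l0 l2.
pose h := p.1 - q.1.
(* The vertical displacement still missing once [h] has been applied. *)
pose z := (p.2 - q.2) - (B h q.1 + 2 *: B gb h).
have hc : `|h| <= c * l.
  by apply: le_trans h1 _; apply: le_trans dlc _; rewrite ler_wpM2l// ltW.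
have [a Ba na] := Hsol h z hc.
have := Hcc h a; rewrite Ba.
have -> : (q.1 + h, q.2 + (B h q.1 + 2 *: B gb h + z)) = p.
  rewrite [RHS]surjective_pairing /h /z; congr pair; apply/rowP => k; rewrite !mxE; ring.
have q1l : `|q.1| <= l := curve_start_le cu iu.
have B2 (x y : 'rV[R]_m) : `|B x y| <= b * (`|x| * `|y|) := B_bound Bsk x y.
have nz : `|z| <= (1 + 3 * b * N p) * dl.
  have b1 : `|B h q.1| <= b * (dl * l).
    by apply: le_trans (B2 _ _) _; rewrite ler_wpM2l// ler_pM.
  have b2 : `|B gb h| <= b * (l * dl).
    by apply: le_trans (B2 _ _) _; rewrite ler_wpM2l// ler_pM.
  have b3 : b * (dl * l) <= b * (dl * N p) by rewrite ler_wpM2l// ler_wpM2l// ltW.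
  apply: le_trans (ler_normB _ _) _.
  have := ler_normD (B h q.1) (2 *: B gb h).
  rewrite [in X in _ <= X -> _]normrZ (ger0_norm (ler0n _ 2)).
  by clear - HB Bsk b0 N0 b1 b2 b3 h2; lra.
have na' : `|a| <= T * dl.
  have nu3 : 0 < nu ^+ 3 by rewrite exprn_gt0.
  have : nu ^+ 3 * `|a| <= K' * ((1 + 3 * b * N p) * dl).
    apply: (@le_trans _ _ (l ^+ 3 * `|a|)).
      by rewrite ler_wpM2r// lerXn2r ?nnegrE// ltW.
    by apply: le_trans na _; rewrite ler_wpM2l.
  have -> : T * dl = K' * ((1 + 3 * b * N p) * dl) / nu ^+ 3.
    by rewrite /T; field; rewrite gt_eqF.
  by rewrite ler_pdivlMr// mulrC.
have t1 : (\sum_k h 0 k * q.1 0 k) / l <= m%:R * dl.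
  rewrite ler_pdivrMr//; apply: le_trans (ler_norm _) _.
  by apply: le_trans (sum_mul_le _ _) _; rewrite -mulrA ler_wpM2l// ler_pM.
have t2 : - \sum_k a 0 k * v 0 k <= T * dl * (m%:R * (2 * N p ^+ 2)).
  rewrite lerNl; apply: lerNnormlW; apply: le_trans (sum_mul_le _ _) _.
  rewrite mulrCA; apply: ler_pM => //.
  apply: ler_wpM2l => //; apply: le_trans Hv _.
  by rewrite ler_wpM2l// lerXn2r ?nnegrE// ltW.
have t3 : m%:R / 2 * l * (`|h| / l + 2 * l * `|a|) ^+ 2
    <= m%:R / 2 * N p * (nu^-1 + 2 * N p * T) ^+ 2 * dl.
  have w : `|h| / l + 2 * l * `|a| <= (nu^-1 + 2 * N p * T) * dl.
    rewrite [leRHS]mulrDl; apply: lerD.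
      by rewrite mulrC ler_pM ?invr_ge0 ?(ltW l0)// lef_pV2 ?posrE.
    rewrite -[leRHS]mulrA; apply: ler_pM => //; first by rewrite mulr_ge0// ltW.
    exact: ler_wpM2l.
  have w0 : 0 <= `|h| / l + 2 * l * `|a|.
    by rewrite addr_ge0 ?mulr_ge0 ?invr_ge0 ?(ltW l0).
  rewrite -[leRHS]mulrA; apply: ler_pM.
  - by rewrite mulr_ge0 ?divr_ge0// ltW.
  - exact: sqr_ge0.
  - by rewrite ler_wpM2l// divr_ge0.
  apply: (@le_trans _ _ (((nu^-1 + 2 * N p * T) * dl) ^+ 2)).
    by rewrite lerXn2r ?nnegrE// (le_trans w0).
  by rewrite exprMn ler_wpM2l ?sqr_ge0// expr2 ler_piMl// ltW.
have EE : E * dl = m%:R * dl + T * dl * (m%:R * (2 * N p ^+ 2))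
    + m%:R / 2 * N p * (nu^-1 + 2 * N p * T) ^+ 2 * dl by rewrite /E; ring.
have dlE' : E * dl + dl <= e / 2 by clear - HB Bsk b0 N0 dlE; lra.
rewrite -/l EE in dlE' * => Hp; exfalso.
by clear - HB Bsk b0 N0 dlE' t1 t2 t3 Hp l1 qsmall dl0; lra.

Qed.

Let B2 (x y : 'rV[R]_m) : `|B x y| <= b * (`|x| * `|y|). Proof. exact: B_bound. Qed.

(** Here [N p] and the size of [h] are both at most [e], a fixed multiple of the latter: [cc_box]
    confines [p] to a box of scale [e], multiplication by [h] keeps that scale, and the ball-box
    bound returns to [N]. *)
Lemma semiconcave_far (c : R) : 0 < c -> exists2 C : R, 0 <= C &
  forall p h, c * N p < `|h| -> N (gmul B p (h, 0)) ^+ 2 <= C * `|h| ^+ 2.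
Proof.
move=> c0; have [K K0 HK] := fine_ball_box.
pose S := Num.sqrt (2 * b); have S0 : 0 <= S := sqrtr_ge0 _.
pose k := c^-1 + 1.
have k1 : 1 <= k by rewrite /k lerDr invr_ge0 ltW.
exists ((K * ((2 + S) * k)) ^+ 2) => [|p h hp]; first exact: sqr_ge0.
have Npk : N p < k * `|h|.
  apply: (@lt_le_trans _ _ (c^-1 * `|h|)); first by rewrite ltr_pdivlMl.
  by rewrite ler_wpM2r// /k lerDl.
have hk : `|h| <= k * `|h| by rewrite ler_peMl.
set e := k * `|h| in Npk hk.
have e0 : 0 <= e by apply: le_trans hk.
have [p1 p2] := cc_box HB Npk.
rewrite -exprMn ler_sqr ?nnegrE//; last first.
  by rewrite mulr_ge0// mulr_ge0// mulr_ge0//; lra.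
apply: le_trans (HK _) _; rewrite /= addr0 -!mulrA ler_wpM2l// -/e mulrDl.
apply: lerD; first by apply: le_trans (ler_normD _ _) _; lra.
have -> : S * e = Num.sqrt (2 * b * e ^+ 2).
  by rewrite sqrtrM ?mulr_ge0// sqrtr_sqr ger0_norm.
rewrite ler_wsqrtr//; apply: le_trans (ler_normD _ _) _.
have : `|B p.1 h| <= b * (e * e).
  by apply: le_trans (B2 _ _) _; rewrite ler_wpM2l// ler_pM.
by move: p2; rewrite -/b expr2; lra.
Qed.

(* With [al+] solving [B (2M - kap h) al+ = z] and [al-] solving the same
   equation for [-h] and [-z], [al+ + al-] is quadratic in [h]; hence so is the
   sum of the two first-order variations of the length. *)
Lemma semiconcave_near : exists c C : R, [/\ 0 < c, 0 <= C & forall p h,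
  h != 0 -> `|h| <= c * N p ->
  N (gmul B p (h, 0)) ^+ 2 + N (gmul B p (- h, 0)) ^+ 2 - 2 * N p ^+ 2 <= C * `|h| ^+ 2].
Proof.
have [c [K [c0 K0 Hs]]] := solvable_perturbation.
(* [A], [A2] and [A3] will bound [al], [ga] and [al'], up to powers of [l]; [D1] bounds the
   first-order term [x], and [D2] enters the second-order term [q]. *)
pose A := 4 * (K * b); have A0 : 0 <= A by rewrite mulr_ge0// mulr_ge0.
pose A2 := 8 * (K * b) * A; have A20 : 0 <= A2 by rewrite !mulr_ge0.
pose A3 := A + A2 * c; have A30 : 0 <= A3 by rewrite addr_ge0// mulr_ge0// ltW.
pose D1 := m%:R * (1 + 2 * A); have D10 : 0 <= D1 by rewrite mulr_ge0// addr_ge0// mulr_ge0.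
pose D2 := m%:R / 2 * (1 + 2 * A3) ^+ 2 + m%:R * (2 * A2).
have D20 : 0 <= D2.
  apply: addr_ge0; first by apply: mulr_ge0; [exact: divr_ge0|exact: sqr_ge0].
  by rewrite !mulr_ge0.
exists c, (2 + 4 * D2 + 2 * (D2 * c) ^+ 2 + 2 * D1 ^+ 2); split=> // [|p h hn0 hc].
  by rewrite !addr_ge0// mulr_ge0// sqr_ge0.
set a := `|h| in hc *; have a0 : 0 < a by rewrite normr_gt0.
have Np : 0 < N p by have := lt_le_trans a0 hc; rewrite pmulr_rgt0.
(* The excess [ep] of the near-optimal length is of second order in [h], so that [l ^+ 2] exceeds
   [N p ^+ 2] by at most [a ^+ 2]. *)
pose ep := Num.min (N p) (a ^+ 2 / (3 * N p)).
have ep0 : 0 < ep by rewrite lt_min Np divr_gt0 ?exprn_gt0// mulr_gt0.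
have epN : ep <= N p by rewrite ge_min lexx.
have epa : 3 * N p * ep <= a ^+ 2.
  by rewrite mulrC -ler_pdivlMr ?mulr_gt0// ge_min lexx orbT.
clearbody ep.
have Npep : N p < N p + ep by rewrite ltrDl.
have [g1 [g2 [u [cu iu lN Nl]]]] := near_optimal_curve HB Npep.
have [l0 l2] : 0 < prim (fun t => enorm (u t)) 1 /\ prim (fun t => enorm (u t)) 1 <= 2 * N p.
  by rewrite -/(N p) in lN; clear - HB Bsk b0 N0 B2 Np lN Nl epN; split; lra.
have [M [gb [v [kap [Hgb Hv Hkap Hsol Hcc]]]]] := Hs _ _ _ _ cu iu l0 l2.
have p1 := curve_start_le cu iu.
set l := prim _ _ in lN Nl l0 l2 Hgb Hv Hkap Hsol Hcc p1.
rewrite -/(N p) in lN.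
have hl : a <= c * l by apply: le_trans hc _; rewrite ler_pM2l.
have lsq : l ^+ 2 <= N p ^+ 2 + a ^+ 2.
  have : l ^+ 2 <= (N p + ep) ^+ 2.
    by rewrite ler_sqr ?nnegrE ?(ltW l0) ?(ltW Nl)// addr_ge0 ?ltW.
  have : ep ^+ 2 <= N p * ep by rewrite expr2 ler_pM2r.
  by clear - HB Bsk b0 N0 B2 epa; lra.
clearbody l.
have l0' := ltW l0; have a0' := ltW a0.
(* Determined by [B h p.1 + 2 *: B gb h + z = B p.1 h], the vertical part of the group law. *)
pose z := 2 *: B (p.1 - gb) h.
have [al Bal nal] := Hsol h z hl.
(* For [- h], the opposite [- al] misses the target [- z] by [2 * kap *: B h al], which [ga]
   supplies. Both [h] and [al] enter this defect, so it is quadratic in [h]. *)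
have [|ga Bga nga] := Hsol (- h) (2 * kap *: B h al); first by rewrite normrN.
pose al' := - al + ga.
have Bal' : B (2 *: M - kap *: - h) al' = - z.
  rewrite /al' (BDr Bsk) Bga (BNr Bsk) -Bal !(BDl Bsk, BNl Bsk, BZl Bsk).
  by apply/rowP => k; rewrite !mxE; ring.
have nz : `|z| <= 4 * b * l * a.
  have : `|B (p.1 - gb) h| <= b * (2 * l * a).
    apply: le_trans (B2 _ _) _; rewrite ler_wpM2l// ler_wpM2r//.
    by apply: le_trans (ler_normB _ _) _; clear - HB Bsk b0 N0 B2 p1 Hgb; lra.
  by rewrite /z normrZ (ger0_norm (ler0n _ 2)); clear - HB Bsk b0 N0 B2; lra.
have al_le : l ^+ 2 * `|al| <= A * a.
  rewrite -(ler_pM2l l0) mulrA -exprS; apply: le_trans nal _.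
  have : K * `|z| <= K * (4 * b * l * a) by rewrite ler_wpM2l.
  by rewrite /A; clear - HB Bsk b0 N0 B2; lra.
have ga_le : l ^+ 3 * `|ga| <= A2 * a ^+ 2.
  apply: le_trans nga _; rewrite normrZ normrM (ger0_norm (ler0n _ 2)).
  have k1 : `|kap| * `|B h al| <= 4 * l ^+ 2 * (b * (a * `|al|)).
    by rewrite ler_pM// B2.
  have k2 : K * (b * a) * (l ^+ 2 * `|al|) <= K * (b * a) * (A * a).
    by rewrite ler_wpM2l// !mulr_ge0.
  have k3 : K * (`|kap| * `|B h al|) <= K * (4 * l ^+ 2 * (b * (a * `|al|))).
    by rewrite ler_wpM2l.
  by rewrite /A2; clear - HB Bsk b0 N0 B2 k2 k3; lra.
have ga_le' : l ^+ 2 * `|ga| <= A2 * a ^+ 2 / l.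
  by rewrite ler_pdivlMr// mulrC mulrA -exprS.
have al'_le : l ^+ 2 * `|al'| <= A3 * a.
  have : l ^+ 2 * `|ga| <= A2 * c * a.
    apply: le_trans ga_le' _; rewrite ler_pdivrMr//.
    by have : A2 * a * a <= A2 * a * (c * l); [rewrite ler_wpM2l// mulr_ge0|clear - HB Bsk b0 N0 B2; lra].
  have : l ^+ 2 * `|al'| <= l ^+ 2 * (`|al| + `|ga|).
    by rewrite ler_wpM2l ?sqr_ge0//; apply: le_trans (ler_normD _ _) _; rewrite normrN.
  by rewrite /A3; clear - HB Bsk b0 N0 B2 al_le; lra.
pose x := (\sum_k h 0 k * p.1 0 k) / l - \sum_k al 0 k * v 0 k.
have xD : `|x| <= D1 * a.
  apply: le_trans (ler_normB _ _) _.
  have x1 : `|(\sum_k h 0 k * p.1 0 k) / l| <= m%:R * a.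
    rewrite normrM normfV (gtr0_norm l0) ler_pdivrMr// -mulrA.
    by apply: le_trans (sum_mul_le _ _) _; rewrite ler_wpM2l// ler_pM.
  have x2 : `|\sum_k al 0 k * v 0 k| <= m%:R * (2 * (A * a)).
    apply: le_trans (sum_mul_le _ _) _; rewrite ler_wpM2l//.
    apply: (@le_trans _ _ (`|al| * (2 * l ^+ 2))); first by rewrite ler_wpM2l.
    by clear - HB Bsk b0 N0 B2 al_le; lra.
  by rewrite /D1; clear - HB Bsk b0 N0 B2 x1 x2; lra.
(* Each occurrence of [w] carries the factor [l ^+ 2], so a bound of order [a / l ^+ 2] on [w] gives
   an error of order [a ^+ 2 / l]. *)
have quad (w : 'rV[R]_m) : l ^+ 2 * `|w| <= A3 * a ->
    m%:R / 2 * l * (a / l + 2 * l * `|w|) ^+ 2 <= m%:R / 2 * (1 + 2 * A3) ^+ 2 * (a ^+ 2 / l).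
  move=> hw.
  have -> : m%:R / 2 * l * (a / l + 2 * l * `|w|) ^+ 2 =
      m%:R / 2 * (a + 2 * (l ^+ 2 * `|w|)) ^+ 2 / l by field; rewrite gt_eqF.
  have -> : m%:R / 2 * (1 + 2 * A3) ^+ 2 * (a ^+ 2 / l) =
      m%:R / 2 * ((1 + 2 * A3) * a) ^+ 2 / l by field; rewrite gt_eqF.
  rewrite ler_wpM2r ?invr_ge0// ler_wpM2l ?divr_ge0//.
  have w0 : 0 <= a + 2 * (l ^+ 2 * `|w|) by rewrite addr_ge0// mulr_ge0// mulr_ge0// sqr_ge0.
  rewrite ler_sqr ?nnegrE//; first by clear - HB Bsk b0 N0 B2 hw; lra.
  by rewrite mulr_ge0// addr_ge0// mulr_ge0.
set q := D2 * (a ^+ 2 / l).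
have al_le3 : l ^+ 2 * `|al| <= A3 * a.
  apply: le_trans al_le _; rewrite ler_wpM2r// /A3 lerDl mulr_ge0// ltW//.
have r0 : 0 <= m%:R * (2 * A2) * (a ^+ 2 / l).
  by rewrite !mulr_ge0 ?sqr_ge0 ?invr_ge0.
have Np_le : N (gmul B p (h, 0)) <= l + x + q.
  have := Hcc h al; rewrite Bal.
  have -> : (p.1 + h, p.2 + (B h p.1 + 2 *: B gb h + z)) = gmul B p (h, 0).
    rewrite /gmul /= /z (BDl Bsk) (BNl Bsk) (BC Bsk h p.1); congr pair.
    by apply/rowP => k; rewrite !mxE; ring.
  have := quad _ al_le3; rewrite -/(N _) -/a /x /q /D2; clear - HB Bsk b0 N0 B2 r0; lra.
have Nm_le : N (gmul B p (- h, 0)) <= l - x + q.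
  have := Hcc (- h) al'; rewrite Bal' normrN.
  have -> : (p.1 + - h, p.2 + (B (- h) p.1 + 2 *: B gb (- h) + - z)) = gmul B p (- h, 0).
    rewrite /gmul /= /z (BDl Bsk) !(BNl Bsk, BNr Bsk) (BC Bsk h p.1); congr pair.
    by apply/rowP => k; rewrite !mxE; ring.
  have -> : \sum_k (- h) 0 k * p.1 0 k = - \sum_k h 0 k * p.1 0 k.
    by rewrite -sumrN; apply: eq_bigr => k _; rewrite mxE mulNr.
  have -> : \sum_k al' 0 k * v 0 k = - (\sum_k al 0 k * v 0 k) + \sum_k ga 0 k * v 0 k.
    by rewrite -sumrN -big_split; apply: eq_bigr => k _; rewrite !mxE /=; ring.
  have gv : - (\sum_k ga 0 k * v 0 k) <= m%:R * (2 * A2) * (a ^+ 2 / l).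
    rewrite lerNl; apply: lerNnormlW; apply: le_trans (sum_mul_le _ _) _.
    rewrite -mulrA ler_wpM2l//.
    apply: (@le_trans _ _ (`|ga| * (2 * l ^+ 2))); first by rewrite ler_wpM2l.
    by clear - HB Bsk b0 N0 B2 ga_le'; lra.
  have := quad _ al'_le; rewrite -/(N _) -/a /x /q /D2; clear - HB Bsk b0 N0 B2 gv; lra.
have q0 : 0 <= q by rewrite !mulr_ge0 ?sqr_ge0 ?invr_ge0.
have qa : q <= D2 * c * a.
  rewrite /q -mulrA ler_wpM2l// ler_pdivrMr//.
  by have : a * a <= a * (c * l); [rewrite ler_wpM2l|clear - HB Bsk b0 N0 B2; lra].
have lq : l * q = D2 * a ^+ 2 by rewrite /q; field; rewrite gt_eqF.
have sq1 : N (gmul B p (h, 0)) ^+ 2 <= (l + x + q) ^+ 2.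
  by rewrite ler_sqr ?nnegrE// (le_trans _ Np_le).
have sq2 : N (gmul B p (- h, 0)) ^+ 2 <= (l - x + q) ^+ 2.
  by rewrite ler_sqr ?nnegrE// (le_trans _ Nm_le).
have x2 : x ^+ 2 <= D1 ^+ 2 * a ^+ 2.
  by rewrite -real_normK ?num_real// -exprMn lerXn2r ?nnegrE// mulr_ge0.
have q2 : q ^+ 2 <= (D2 * c) ^+ 2 * a ^+ 2.
  by rewrite -exprMn lerXn2r ?nnegrE// !mulr_ge0// ltW.
clearbody x q.
have -> : (2 + 4 * D2 + 2 * (D2 * c) ^+ 2 + 2 * D1 ^+ 2) * a ^+ 2 =
   2 * a ^+ 2 + 4 * (l * q) + 2 * ((D2 * c) ^+ 2 * a ^+ 2) + 2 * (D1 ^+ 2 * a ^+ 2).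
  by rewrite lq; ring.
(* The products [l * x] and [x * q] cancel in the sum; [l * q], [q ^+ 2] and [x ^+ 2] are all of
   second order in [h]. *)
have e1 : (l + x + q) ^+ 2 + (l - x + q) ^+ 2 =
    2 * l ^+ 2 + 4 * (l * q) + 2 * q ^+ 2 + 2 * x ^+ 2.
  by ring.
by clear - HB Bsk b0 N0 B2 sq1 sq2 x2 q2 lsq e1; lra.
Qed.

End Semiconcavity.

Theorem theorem3p1 (R : realType) (m n2 : nat)
    (B : 'rV[R]_m -> 'rV[R]_m -> 'rV[R]_n2) :
  ideal_carnot B ->
  (forall p : carnot_pt R m n2, cc_dist B p 0 \is a fin_num) /\
  h_semiconcave B setT (fun p : carnot_pt R m n2 => fine (cc_dist B p 0) ^+ 2).
Proof.
(* Finiteness ensures that [fine] does not turn an infinite distance into [0]. *)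
move=> HB; split; first exact: cc_dist_fin.
split; first by move=> p _; exists 1.
split; first exact: cc_dist_lsc.
have [c [C1 [c0 C10 near_]]] := semiconcave_near HB.
have [C2 C20 far] := semiconcave_far HB c0.
exists (C1 + 2 * C2) => [|p h _ _]; first by rewrite addr_ge0// mulr_ge0.
(* The estimates were made in the sup norm, which the Euclidean norm dominates. *)
apply: (@le_trans _ _ ((C1 + 2 * C2) * `|h| ^+ 2)); last first.
  rewrite ler_wpM2l ?addr_ge0 ?mulr_ge0// ler_sqr ?nnegrE ?enorm_ge0//.
  exact: norm_le_enorm.
rewrite [leRHS]mulrDl; have [->|h0] := eqVneq h 0.
  rewrite oppr0.
  have -> : gmul B p (0, 0) = p.
    have B0r : B p.1 0 = 0 by have [Bsk _] := HB; rewrite (BC Bsk) (B0l Bsk) oppr0.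
    by rewrite /gmul /= B0r !addr0 -surjective_pairing.
  by rewrite normr0 expr0n !mulr0; lra.
have [hc|hc] := leP `|h| (c * fine (cc_dist B p 0)).
  apply: le_trans (near_ _ _ h0 hc) _.
  by rewrite lerDl mulr_ge0 ?sqr_ge0// mulr_ge0.
(* Far from the small-step regime both squares are bounded separately, and [- 2 N p ^+ 2] is
   dropped. *)
have f1 := far _ _ hc.
have f2 : fine (cc_dist B (gmul B p (- h, 0)) 0) ^+ 2 <= C2 * `|h| ^+ 2.
  by rewrite -(normrN h); apply: far; rewrite normrN.
have := sqr_ge0 (fine (cc_dist B p 0)).
have : 0 <= C1 * `|h| ^+ 2 by rewrite mulr_ge0// sqr_ge0.
by move: f1 f2; rewrite -mulrA; lra.
Qed.
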